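(* Let $G$ be a commutator-relators group with $H_2(G)$ torsion-free, and let $n=\operatorname{rank} G/G_2$. For every prime $p$ and every integer $0\le d\le n-1$, \[ \nu_{p,d}(G/G_3)=\#\bigl(\mathcal{P}_d(G,\mathbb{Z}_p)\setminus\mathcal{P}_{d+1}(G,\mathbb{Z}_p)\bigr). \]
   Context: A commutator-relators group is a group with a finite presentation $\langle x_1,\dots,x_n\mid r_1,\dots,r_m\rangle$ in which all relators lie in the commutator subgroup of the free group on $x_1,\dots,x_n$; then $G/G_2\cong\mathbb{Z}^n$. Lower central series: $G_1=G$, $G_{q+1}=[G,G_q]$. $\mathbb{Z}_p$ is the field with $p$ elements. $\nu_{p,d}(G/G_3)$ is the number of normal subgroups $K\lhd G/G_3$ with $[G/G_3:K]=p$ and $\dim_{\mathbb{Z}_p}(\operatorname{Tors}H_1(K))\otimes\mathbb{Z}_p=d$. For $0\le d\le n$, $\mathcal{R}_d(G,\mathbb{Z}_p)$ is the set of $\lambda\in H^1(G,\mathbb{Z}_p)=\mathbb{Z}_p^n$ for which there is a subspace $W\subset H^1(G,\mathbb{Z}_p)$ with $\dim W=d+1$ and $\lambda\cup w=0$ in $H^2(G,\mathbb{Z}_p)$ for all $w\in W$ (so $\mathcal{R}_0=\mathbb{Z}_p^n$ and $\mathcal{R}_n=\emptyset$). It is closed under scaling by nonzero scalars, and $\mathcal{P}_d(G,\mathbb{Z}_p)\subset\mathbb{P}(\mathbb{Z}_p^n)$ is the set of lines spanned by nonzero elements of $\mathcal{R}_d(G,\mathbb{Z}_p)$. *)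

(* Defs.v *)
From HB Require Import structures.
From mathcomp Require Import all_boot all_order all_algebra.
From mathcomp Require Import finmap mathcomp_extra boolp classical_sets.
From mathcomp Require Import functions cardinality.
From mathcomp.multinomials Require Import freeg.

Set Implicit Arguments.
Unset Strict Implicit.
Unset Printing Implicit Defensive.

Import GRing.Theory.
Local Open Scope quotient_scope.
Local Open Scope classical_set_scope.
Local Open Scope card_scope.

Section Groups.
Local Open Scope group_scope.

Inductive gspan (G : groupType) (S : set G) : set G :=
| gspan_gen x of S x : gspan S x
| gspan1 : gspan S 1
| gspanM x y of gspan S x & gspan S y : gspan S (x * y)
| gspanV x of gspan S x : gspan S x^-1.

Definition normal_subgroup (G : groupType) (N : set G) :=
  [/\ N 1,
      forall x y, N x -> N y -> N (x * y),
      forall x, N x -> N x^-1 &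
      forall x g, N x -> N (x ^ g)].

Definition conjugates (G : groupType) (S : set G) : set G :=
  [set x | exists s g, S s /\ x = s ^ g].

Definition normal_closure (G : groupType) (S : set G) : set G :=
  gspan (conjugates S).

Lemma normal_closure_normal (G : groupType) (S : set G) :
  normal_subgroup (normal_closure S).
Proof.
split=> [|x y|x|x g]; [exact: gspan1|exact: gspanM|exact: gspanV|].
elim=> {x} [x [s [h [Ss ->]]]||x y _ IHx _ IHy|x _ IHx].
- by apply: gspan_gen; exists s, (h * g); rewrite conjgM.
- by rewrite conj1g; exact: gspan1.
- by rewrite conjMg; exact: gspanM.
- by rewrite conjVg; exact: gspanV.
Qed.

(* The commutator [A, B] of two subgroups.                                    *)
Definition commsub (G : groupType) (A B : set G) : set G :=
  gspan [set x | exists a b, [/\ A a, B b & x = [~ a, b]]].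

(* The lower central series, indexed from 1: G_1 = G, G_(q+1) = [G, G_q];     *)
(* the value at 0 is a dummy.                                                 *)
Unset Implicit Arguments.
Fixpoint lower_central (G : groupType) (q : nat) : set G :=
  match q with
  | 0 | 1 => setT
  | q'.+1 => commsub setT (lower_central G q')
  end.
Set Implicit Arguments.

Lemma lower_central_normal (G : groupType) (q : nat) :
  normal_subgroup (lower_central G q).
Proof.
elim: q => [//|[//|q] [_ _ _ IH]].
split; [exact: gspan1|by move=> x y; exact: gspanM|by move=> x; exact: gspanV|].
move=> x g; elim=> {x} [x [a [b [_ Bb ->]]]||x y _ IHx _ IHy|x _ IHx].
- rewrite conjRg; apply: gspan_gen; exists (a ^ g), (b ^ g); split=> //.
  exact: IH.
- by rewrite conj1g; exact: gspan1.
- by rewrite conjMg; exact: gspanM.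
- by rewrite conjVg; exact: gspanV.
Qed.

Lemma normal_closure_id (G : groupType) (N : set G) :
  normal_subgroup N -> normal_closure N = N.
Proof.
move=> [N1 NM NV NJ]; apply/seteqP; split=> x; last first.
  by move=> Nx; apply: gspan_gen; exists x, 1; rewrite conjg1.
elim=> {x} [x [s [g [Ns ->]]]||x y _ Nx _ Ny|x _ Nx] //; first exact: NJ.
- exact: NM.
- exact: NV.
Qed.

End Groups.

(* The subgroup of G generated by S, which is S itself when S is a subgroup.  *)
Section SubgroupType.
Local Open Scope group_scope.
Variables (G : groupType) (S : set G).

Definition in_gspan : {pred G} := fun x => `[< gspan S x >].

Lemma in_gspan_closed : group_closed in_gspan.
Proof.
split; first exact/asboolP/gspan1.
move=> x y /asboolP Sx /asboolP Sy; apply/asboolP.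
by apply: gspanM => //; exact: gspanV.
Qed.

Definition subgroup_type := {x : G | in_gspan x}.
HB.instance Definition _ := SubType.on subgroup_type.
HB.instance Definition _ := Choice.on subgroup_type.
HB.instance Definition _ := SubChoice.on subgroup_type.
HB.instance Definition _ :=
  SubChoice_isSubGroup.Build G in_gspan subgroup_type in_gspan_closed.

End SubgroupType.

(* The quotient of G by the normal closure of S, i.e. G / S when S is a       *)
(* normal subgroup (see normal_closure_id).                                   *)
Section QuotientGroup.
Local Open Scope group_scope.
Variables (G : groupType) (S : set G).
Let N := normal_closure S.

Definition coset_eq : rel G := fun x y => `[< N (x^-1 * y) >].

Lemma coset_eq_equiv : equiv_class_of coset_eq.
Proof.
have [N1 NM NV _] := normal_closure_normal S.
split=> [x|x y|y x z].
- by apply/asboolP; rewrite mulVg.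
- by apply/asboolP/asboolP => /NV; rewrite invgM invgK.
- move=> /asboolP Nxy /asboolP Nyz; apply/asboolP.
  by have := NM _ _ Nxy Nyz; rewrite -mulgA mulVKg.
Qed.

Canonical coset_equiv := EquivRelPack coset_eq_equiv.
Canonical coset_equiv_direct := defaultEncModRel coset_eq.

Definition group_quotient := {eq_quot coset_eq}.
HB.instance Definition _ := Choice.on group_quotient.
HB.instance Definition _ := EqQuotient.on group_quotient.

Definition quotient_pi (x : G) : group_quotient := \pi_group_quotient x.

Lemma quotient_piP x y :
  reflect (quotient_pi x = quotient_pi y) `[< N (x^-1 * y) >].
Proof. exact: (@eqmodP _ coset_equiv x y). Qed.

Lemma quotient_repr (u : group_quotient) : quotient_pi (repr u) = u.
Proof. exact: reprK. Qed.

Definition quotient_mul (u v : group_quotient) :=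
  quotient_pi (repr u * repr v).
Definition quotient_inv (u : group_quotient) := quotient_pi (repr u)^-1.

Lemma quotient_mulE x y :
  quotient_mul (quotient_pi x) (quotient_pi y) = quotient_pi (x * y).
Proof.
have [N1 NM NV NJ] := normal_closure_normal S.
rewrite /quotient_mul; apply/quotient_piP/asboolP.
have /quotient_piP/asboolP Nx := quotient_repr (quotient_pi x).
have /quotient_piP/asboolP Ny := quotient_repr (quotient_pi y).
have := NM _ _ (NJ _ (repr (quotient_pi y)) Nx) Ny.
by rewrite conjgE invgM !mulgA mulgK.
Qed.

Lemma quotient_invE x : quotient_inv (quotient_pi x) = quotient_pi x^-1.
Proof.
have [N1 NM NV NJ] := normal_closure_normal S.
rewrite /quotient_inv; apply/quotient_piP/asboolP; rewrite invgK.
have /quotient_piP/asboolP Nx := quotient_repr (quotient_pi x).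
have := NV _ (NJ _ (repr (quotient_pi x))^-1 Nx).
by rewrite conjgE invgK !mulgA mulgV mul1g invgM invgK.
Qed.

Lemma quotient_mulA : associative quotient_mul.
Proof.
move=> u v w; rewrite -(quotient_repr u) -(quotient_repr v) -(quotient_repr w).
by rewrite !quotient_mulE mulgA.
Qed.

Lemma quotient_mul1 : left_id (quotient_pi 1) quotient_mul.
Proof. by move=> u; rewrite -(quotient_repr u) quotient_mulE mul1g. Qed.

Lemma quotient_mulr1 : right_id (quotient_pi 1) quotient_mul.
Proof. by move=> u; rewrite -(quotient_repr u) quotient_mulE mulg1. Qed.

Lemma quotient_mulV : left_inverse (quotient_pi 1) quotient_inv quotient_mul.
Proof.
by move=> u; rewrite -(quotient_repr u) quotient_invE quotient_mulE mulVg.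
Qed.

Lemma quotient_mulrV : right_inverse (quotient_pi 1) quotient_inv quotient_mul.
Proof.
by move=> u; rewrite -(quotient_repr u) quotient_invE quotient_mulE mulgV.
Qed.

HB.instance Definition _ := isGroup.Build group_quotient
  quotient_mulA quotient_mul1 quotient_mulr1 quotient_mulV quotient_mulrV.

End QuotientGroup.

(* The free group on X: words in the letters (x, false) = x and               *)
(* (x, true) = x^-1, up to free reduction.                                    *)
Section FreeGroup.
Variable X : choiceType.

Definition word := seq (X * bool).
Implicit Types u v w : word.

Inductive word_eq : word -> word -> Prop :=
| word_eq_cancel u v x b :
    word_eq (u ++ [:: (x, b), (x, ~~ b) & v]) (u ++ v)
| word_eq_refl u : word_eq u u
| word_eq_sym u v of word_eq u v : word_eq v u
| word_eq_trans u v w of word_eq u v & word_eq v w : word_eq u w.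

Definition word_inv u : word := rev [seq (l.1, ~~ l.2) | l <- u].

Lemma word_eq_cat u u' v v' :
  word_eq u u' -> word_eq v v' -> word_eq (u ++ v) (u' ++ v').
Proof.
move=> uu' vv'; apply: (@word_eq_trans _ (u' ++ v)).
  elim: uu' => {u u' vv'} [u w x b|u|u w _|u w z _ uw _ wz].
  - by rewrite -!catA; exact: word_eq_cancel.
  - exact: word_eq_refl.
  - exact: word_eq_sym.
  - exact: word_eq_trans wz.
elim: vv' => {u v v' uu'} [u w x b|u|u w _|u w z _ uw _ wz].
- by rewrite !catA; exact: word_eq_cancel.
- exact: word_eq_refl.
- exact: word_eq_sym.
- exact: word_eq_trans wz.
Qed.

Lemma word_invM u v : word_inv (u ++ v) = word_inv v ++ word_inv u.
Proof. by rewrite /word_inv map_cat rev_cat. Qed.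

Lemma word_invK : involutive word_inv.
Proof.
move=> u; rewrite /word_inv map_rev revK -map_comp -[RHS]map_id.
by apply: eq_map => -[x b] /=; rewrite negbK.
Qed.

Lemma word_eq_inv u v : word_eq u v -> word_eq (word_inv u) (word_inv v).
Proof.
elim=> {u v} [u v x b|u|u v _|u v w _ uv _ vw].
- rewrite -cat1s -[_ :: v]cat1s !word_invM /word_inv /= -!catA.
  by rewrite negbK; exact: word_eq_cancel.
- exact: word_eq_refl.
- exact: word_eq_sym.
- exact: word_eq_trans vw.
Qed.

Lemma word_eq_mulV u : word_eq (word_inv u ++ u) [::].
Proof.
elim: u => [|[x b] u IHu]; first exact: word_eq_refl.
apply: word_eq_trans IHu.
rewrite -cat1s word_invM -!catA /=.
by rewrite -{2}[b]negbK; exact: word_eq_cancel.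
Qed.

Definition word_eqb : rel word := fun u v => `[< word_eq u v >].

Lemma word_eqb_equiv : equiv_class_of word_eqb.
Proof.
split=> [u|u v|v u w].
- by apply/asboolP; exact: word_eq_refl.
- by apply/asboolP/asboolP; exact: word_eq_sym.
- by move=> /asboolP uv /asboolP vw; apply/asboolP; exact: word_eq_trans vw.
Qed.

Canonical word_equiv := EquivRelPack word_eqb_equiv.
Canonical word_equiv_direct := defaultEncModRel word_eqb.

Definition free_group := {eq_quot word_eqb}.
HB.instance Definition _ := Choice.on free_group.
HB.instance Definition _ := EqQuotient.on free_group.

Definition free_pi u : free_group := \pi_free_group u.

Lemma free_piP u v : reflect (free_pi u = free_pi v) `[< word_eq u v >].
Proof. exact: (@eqmodP _ word_equiv u v). Qed.

Lemma free_repr (a : free_group) : free_pi (repr a) = a.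
Proof. exact: reprK. Qed.

Definition free_mul (a b : free_group) := free_pi (repr a ++ repr b).
Definition free_inv (a : free_group) := free_pi (word_inv (repr a)).

Lemma free_mulE u v : free_mul (free_pi u) (free_pi v) = free_pi (u ++ v).
Proof.
by rewrite /free_mul; apply/free_piP/asboolP/word_eq_cat; apply/asboolP/free_piP/free_repr.
Qed.

Lemma free_invE u : free_inv (free_pi u) = free_pi (word_inv u).
Proof.
by rewrite /free_inv; apply/free_piP/asboolP/word_eq_inv; apply/asboolP/free_piP/free_repr.
Qed.

Lemma free_mulA : associative free_mul.
Proof.
move=> a b c; rewrite -(free_repr a) -(free_repr b) -(free_repr c).
by rewrite !free_mulE catA.
Qed.

Lemma free_mul1 : left_id (free_pi [::]) free_mul.
Proof. by move=> a; rewrite -(free_repr a) free_mulE. Qed.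

Lemma free_mulr1 : right_id (free_pi [::]) free_mul.
Proof. by move=> a; rewrite -(free_repr a) free_mulE cats0. Qed.

Lemma free_mulV : left_inverse (free_pi [::]) free_inv free_mul.
Proof.
move=> a; rewrite -(free_repr a) free_invE free_mulE.
exact/free_piP/asboolP/word_eq_mulV.
Qed.

Lemma free_mulrV : right_inverse (free_pi [::]) free_inv free_mul.
Proof.
move=> a; rewrite -(free_repr a) free_invE free_mulE.
by apply/free_piP/asboolP; rewrite -{1}[repr a]word_invK; exact: word_eq_mulV.
Qed.

HB.instance Definition _ := isGroup.Build free_group
  free_mulA free_mul1 free_mulr1 free_mulV free_mulrV.

End FreeGroup.

Definition isomorphic (G H : groupType) : Prop :=
  exists f : G -> H, bijective f /\ {morph f : x y / (x * y)%g}.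

Definition commutator_relators (G : groupType) : Prop :=
  exists (n m : nat) (r : 'I_m -> free_group 'I_n),
    (forall j, commsub setT setT (r j)) /\
    isomorphic G (group_quotient (range r)).

Definition expz (G : groupType) (x : G) (k : int) : G :=
  match k with Posz m => (x ^+ m)%g | Negz m => (x ^- m.+1)%g end.

Definition Z_independent (A : groupType) (k : nat) (e : 'I_k -> A) : Prop :=
  forall c : 'I_k -> int,
    (\prod_(i < k) expz (e i) (c i) = 1)%g -> forall i, c i = 0%R.

(* The rank of an abelian group A, written multiplicatively: the largest      *)
(* size of a family that is linearly independent over Z.                      *)
Definition abelian_rank (A : groupType) (n : nat) : Prop :=
  (exists e : 'I_n -> A, Z_independent e) /\
  (forall k (e : 'I_k -> A), Z_independent e -> (k <= n)%N).

Inductive lspan (R : nzRingType) (V : lmodType R) (S : set V) : set V :=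
| lspan_gen x of S x : lspan S x
| lspan0 : lspan S 0%R
| lspanP a x y of lspan S x & lspan S y : lspan S (a *: x + y)%R.

Section SubmoduleType.
Local Open Scope ring_scope.
Variables (R : nzRingType) (V : lmodType R) (S : set V).

Definition in_lspan : {pred V} := fun x => `[< lspan S x >].

Lemma in_lspan_closed : submod_closed in_lspan.
Proof.
split; first exact/asboolP/lspan0.
by move=> a x y /asboolP Sx /asboolP Sy; apply/asboolP; exact: lspanP.
Qed.

(* The submodule of V spanned by S, which is S itself when S is a submodule.  *)
Definition submodule_type := {x : V | in_lspan x}.
HB.instance Definition _ := SubType.on submodule_type.
HB.instance Definition _ := Choice.on submodule_type.
HB.instance Definition _ := SubChoice.on submodule_type.
HB.instance Definition _ := GRing.SubChoice_isSubLmodule.Build R V in_lspan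
  submodule_type in_lspan_closed.

End SubmoduleType.

(* The quotient of the module V by the submodule spanned by S.                *)
Section QuotientModule.
Local Open Scope ring_scope.
Variables (R : nzRingType) (V : lmodType R) (S : set V).

Lemma lspanB x y : lspan S x -> lspan S y -> lspan S (x - y).
Proof. by move=> Sx Sy; rewrite addrC -scaleN1r; exact: lspanP. Qed.

Lemma lspanN x : lspan S x -> lspan S (- x).
Proof. by move=> Sx; rewrite -sub0r; apply: lspanB => //; exact: lspan0. Qed.

Lemma lspanD x y : lspan S x -> lspan S y -> lspan S (x + y).
Proof. by move=> Sx Sy; rewrite -[x]scale1r; exact: lspanP. Qed.

Lemma lspanZ a x : lspan S x -> lspan S (a *: x).
Proof. by move=> Sx; rewrite -[_ *: _]addr0; apply: lspanP => //; exact: lspan0.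
Qed.

Definition lcoset_eq : rel V := fun x y => `[< lspan S (x - y) >].

Lemma lcoset_eq_equiv : equiv_class_of lcoset_eq.
Proof.
split=> [x|x y|y x z].
- by apply/asboolP; rewrite subrr; exact: lspan0.
- by apply/asboolP/asboolP => /lspanN; rewrite opprB.
- move=> /asboolP Sxy /asboolP Syz; apply/asboolP.
  by have := lspanD Sxy Syz; rewrite addrA subrK.
Qed.

Canonical lcoset_equiv := EquivRelPack lcoset_eq_equiv.
Canonical lcoset_equiv_direct := defaultEncModRel lcoset_eq.

Definition module_quotient := {eq_quot lcoset_eq}.
HB.instance Definition _ := Choice.on module_quotient.
HB.instance Definition _ := EqQuotient.on module_quotient.

Definition lquot_pi (x : V) : module_quotient := \pi_module_quotient x.

Lemma lquot_piP x y : reflect (lquot_pi x = lquot_pi y) `[< lspan S (x - y) >].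
Proof. exact: (@eqmodP _ lcoset_equiv x y). Qed.

Lemma lquot_repr (u : module_quotient) : lquot_pi (repr u) = u.
Proof. exact: reprK. Qed.

Lemma lspan_repr x : lspan S (repr (lquot_pi x) - x).
Proof. by apply/asboolP/lquot_piP/lquot_repr. Qed.

Definition lquot_add (u v : module_quotient) := lquot_pi (repr u + repr v).
Definition lquot_opp (u : module_quotient) := lquot_pi (- repr u).
Definition lquot_scale a (u : module_quotient) := lquot_pi (a *: repr u).

Lemma lquot_addE x y : lquot_add (lquot_pi x) (lquot_pi y) = lquot_pi (x + y).
Proof.
rewrite /lquot_add; apply/lquot_piP/asboolP; rewrite opprD addrACA.
by apply: lspanD; exact: lspan_repr.
Qed.

Lemma lquot_oppE x : lquot_opp (lquot_pi x) = lquot_pi (- x).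
Proof.
by rewrite /lquot_opp; apply/lquot_piP/asboolP; rewrite -opprD; apply/lspanN/lspan_repr.
Qed.

Lemma lquot_scaleE a x : lquot_scale a (lquot_pi x) = lquot_pi (a *: x).
Proof.
by rewrite /lquot_scale; apply/lquot_piP/asboolP; rewrite -scalerBr; apply/lspanZ/lspan_repr.
Qed.

Lemma lquot_addA : associative lquot_add.
Proof.
move=> u v w; rewrite -(lquot_repr u) -(lquot_repr v) -(lquot_repr w).
by rewrite !lquot_addE addrA.
Qed.

Lemma lquot_addC : commutative lquot_add.
Proof.
move=> u v; rewrite -(lquot_repr u) -(lquot_repr v).
by rewrite !lquot_addE addrC.
Qed.

Lemma lquot_add0 : left_id (lquot_pi 0) lquot_add.
Proof. by move=> u; rewrite -(lquot_repr u) lquot_addE add0r. Qed.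

Lemma lquot_addN : left_inverse (lquot_pi 0) lquot_opp lquot_add.
Proof.
by move=> u; rewrite -(lquot_repr u) lquot_oppE lquot_addE addNr.
Qed.

HB.instance Definition _ := GRing.isZmodule.Build module_quotient
  lquot_addA lquot_addC lquot_add0 lquot_addN.

Lemma lquot_scaleA a b u :
  lquot_scale a (lquot_scale b u) = lquot_scale (a * b) u.
Proof. by rewrite -(lquot_repr u) !lquot_scaleE scalerA. Qed.

Lemma lquot_scale1 : left_id 1 lquot_scale.
Proof. by move=> u; rewrite -(lquot_repr u) lquot_scaleE scale1r. Qed.

Lemma lquot_scaleDr : right_distributive lquot_scale +%R.
Proof.
move=> a u v; rewrite -(lquot_repr u) -(lquot_repr v).
rewrite /GRing.add /= !(lquot_scaleE, lquot_addE).
by rewrite scalerDr.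
Qed.

Lemma lquot_scaleDl u : {morph lquot_scale^~ u : a b / a + b}.
Proof.
move=> a b; rewrite -(lquot_repr u).
by rewrite [RHS]/GRing.add /= !(lquot_scaleE, lquot_addE) scalerDl.
Qed.

HB.instance Definition _ := GRing.Zmodule_isLmodule.Build R module_quotient
  lquot_scaleA lquot_scale1 lquot_scaleDr lquot_scaleDl.

End QuotientModule.

Section Modules.
Local Open Scope ring_scope.

Definition subspace (F : fieldType) (V : lmodType F) (W : set V) : Prop :=
  W 0 /\ forall a x y, W x -> W y -> W (a *: x + y).

(* The subspace W has a basis of size d.                                      *)
Definition dimension (F : fieldType) (V : lmodType F) (W : set V) (d : nat) :=
  exists e : 'I_d -> V, (forall i, W (e i)) /\
    forall v, W v ->
      exists! c : {ffun 'I_d -> F}, v = \sum_(i < d) c i *: e i.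

Definition torsion (A : lmodType int) : set A :=
  [set x | exists m : int, m != 0 /\ m *: x = 0].
Arguments torsion : clear implicits.

Definition Tors (A : lmodType int) := submodule_type (torsion A).

Definition torsion_free (A : lmodType int) : Prop :=
  forall x, torsion A x -> x = 0.

(* A (x) F, generated as an F-module by the symbols << a >> = a (x) 1 for *)
(* a in A, subject to additivity in a.                                        *)
Definition tensor (A : zmodType) (F : nzRingType) :=
  @module_quotient F {freeg A / F}
    [set t | exists a b : A, t = << a + b >> - << a >> - << b >>].

End Modules.

(* Integral homology in degrees 1 and 2, from the (unnormalized,              *)
(* inhomogeneous) bar complex with trivial coefficients.                      *)
Section Homology.
Local Open Scope ring_scope.
Variable G : groupType.

Definition bar_d2 : {freeg (G * G) / int} -> {freeg G / int} :=
  fglift (fun x : G * G => let: (g, h) := x in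
    << h >> - << (g * h)%g >> + << g >>).

Definition bar_d3 : {freeg (G * G * G) / int} -> {freeg (G * G) / int} :=
  fglift (fun x : G * G * G => let: (g, h, k) := x in
    << (h, k) >> - << ((g * h)%g, k) >> + << (g, (h * k)%g) >> - << (g, h) >>).

(* The differential in degree 1 is zero: all 1-chains are cycles.             *)
Definition homology1 := @module_quotient int {freeg G / int} (range bar_d2).

Definition cycles2 := @submodule_type int {freeg (G * G) / int}
  [set z | bar_d2 z = 0].

Definition homology2 := @module_quotient int cycles2
  [set z | exists c, val z = bar_d3 c].

End Homology.

(* Cohomology with trivial coefficients in F_p, from the inhomogeneous        *)
(* cochain complex. The degree 0 differential is zero, so that H^1 is the     *)
(* space of 1-cocycles, i.e. of homomorphisms from G to F_p.                  *)
Section Cohomology.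
Local Open Scope ring_scope.
Variables (G : groupType) (p : nat).
Local Notation C1 := (G -> ('F_p)^o).

Definition cohomology1 : set C1 :=
  [set f | forall g h, f (g * h)%g = f g + f h].

Definition coboundaries2 : set (G -> G -> 'F_p) :=
  [set b | exists f : C1,
     forall g h, b g h = f h - f (g * h)%g + f g].

Definition cup (l w : C1) : G -> G -> 'F_p :=
  fun g h => l g * w h.

Definition resonance (d : nat) : set C1 :=
  [set l | cohomology1 l /\ exists W : set C1,
     [/\ W `<=` cohomology1, subspace W, dimension W d.+1 &
         forall w, W w -> coboundaries2 (cup l w)]].

Definition line (l : C1) : set C1 :=
  [set c *: l | c in [set: 'F_p]].

(* A point of the projective space of H^1 is a line in H^1.                   *)
Definition proj_resonance (d : nat) : set (set C1) :=
  [set L | exists l, [/\ resonance d l, l != 0 & L = line l]].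

End Cohomology.

Arguments cohomology1 : clear implicits.
Arguments resonance : clear implicits.
Arguments proj_resonance : clear implicits.

Definition left_cosets (G : groupType) (K : set G) : set (set G) :=
  [set [set (g * k)%g | k in K] | g in [set: G]].

(* The normal subgroups K of index p in Q such that the dimension of          *)
(* Tors H_1(K) (x) F_p is d.                                                  *)
Definition nu_set (p d : nat) (Q : groupType) : set (set Q) :=
  [set K | [/\ normal_subgroup K, left_cosets K #= `I_p &
     dimension [set: tensor (Tors (homology1 (subgroup_type K))) 'F_p] d]].
Arguments nu_set : clear implicits.

Definition nu (p d : nat) (Q : groupType) : nat := #|` fset_set (nu_set p d Q)|.

(* Main.v *)
(* Let Q = G/G_3 and let K be the kernel of a nonzero character l : Q -> F_p.
   Choose g0 with l(g0) = 1. As commutators are central in Q, and as Q/[Q,Q]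
   is torsion-free (the relators are commutators), the torsion T of H_1(K) is
   [Q,Q]/[K,K]; writing elements of Q as g0^i k with k in K, the relation
     [a, b] = l(a) [g0, b] - l(b) [g0, a]   in V = T (x) F_p
   shows that c : g |-> [g0, g] is a surjective homomorphism Q -> V.

   Composition with c identifies the linear forms on V with the classes w such
   that w(g0) = 0 and l u w = 0 in H^2(G). If f is a cochain with coboundary
   l u w, then f is a homomorphism on the kernel of l with
   f [a, b] = l(b) w(a) - l(a) w(b), so that it kills G_3 and -f induces a
   linear form inducing w. Conversely, given such a form, the solution f of
   f(uv) = f(u) + f(v) - l(u) w(v) on the free group takes on commutators the
   values prescribed by the form, and hence vanishes on the relators and
   descends to G.

   Since l u l = 0 by the same argument, the annihilator of l has dimension
   1 + dim V. Finally, the subgroups of index p correspond to the lines of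
   characters. *)
Require Import Defs.
From HB Require Import structures.
From mathcomp.multinomials Require Import freeg.
From mathcomp Require Import fingroup cyclic.
From mathcomp Require Import all_boot all_order all_algebra.
From mathcomp Require Import ring.
From mathcomp Require Import finmap boolp classical_sets functions cardinality.

Set Implicit Arguments.
Unset Strict Implicit.
Unset Printing Implicit Defensive.

Import GRing.Theory.
Local Open Scope classical_set_scope.
Local Open Scope ring_scope.

(** * Homomorphisms, quotients and commutator subgroups *)

Section GroupHomToModule.
Variables (G : groupType) (M : zmodType) (f : G -> M).
Hypothesis fM : {morph f : x y / (x * y)%g >-> x + y}.

Lemma ghom1 : f 1%g = 0.
Proof. by apply: (addrI (f 1%g)); rewrite -fM mulg1 addr0. Qed.

Lemma ghomV x : f x^-1%g = - f x.
Proof. by apply/eqP; rewrite -addr_eq0 -fM mulVg ghom1. Qed.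

Lemma ghomX x k : f (x ^+ k)%g = f x *+ k.
Proof.
by elim: k => [|k IHk]; rewrite ?expg0 ?ghom1 // expgS fM IHk mulrS.
Qed.

Lemma ghomR x y : f [~ x, y]%g = 0.
Proof. by rewrite commgEl conjgE !fM !ghomV [f x + f y]addrC addKr addNr. Qed.

Lemma ghom_commsub A B x : commsub A B x -> f x = 0.
Proof.
elim=> {x} [x [a [b [_ _ ->]]]||x y _ IHx _ IHy|x _ IHx].
- exact: ghomR.
- exact: ghom1.
- by rewrite fM IHx IHy addr0.
- by rewrite ghomV IHx oppr0.
Qed.

End GroupHomToModule.

Section MorphismGroups.
Local Open Scope group_scope.
Variables (A B : groupType) (phi : A -> B).
Hypothesis phiM : {morph phi : x y / x * y}.

Lemma gmorph1 : phi 1 = 1.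
Proof. by apply: (mulgI (phi 1)); rewrite -phiM !mulg1. Qed.

Lemma gmorphV x : phi x^-1 = (phi x)^-1.
Proof. by apply: (mulgI (phi x)); rewrite -phiM !mulgV gmorph1. Qed.

Lemma gmorphR x y : phi [~ x, y] = [~ phi x, phi y].
Proof. by rewrite !commgEl !conjgE !phiM !gmorphV. Qed.

Lemma gmorph_commsub x : commsub setT setT x -> commsub setT setT (phi x).
Proof.
elim=> {x} [x [a [b [_ _ ->]]]||x y _ IHx _ IHy|x _ IHx].
- by apply: gspan_gen; exists (phi a), (phi b); rewrite gmorphR.
- by rewrite gmorph1; exact: gspan1.
- by rewrite phiM; exact: gspanM.
- by rewrite gmorphV; exact: gspanV.
Qed.

Hypothesis phi_surj : forall y, exists x, phi x = y.

Lemma commsub_lift y : commsub setT setT y ->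
  exists2 x, commsub setT setT x & phi x = y.
Proof.
elim=> {y} [y [a [b [_ _ ->]]]||y z _ [x Cx <-] _ [u Cu <-]|y _ [x Cx <-]].
- have [[x <-] [u <-]] := (phi_surj a, phi_surj b).
  by exists [~ x, u]; [apply: gspan_gen; exists x, u|rewrite gmorphR].
- by exists 1; [exact: gspan1|rewrite gmorph1].
- by exists (x * u); [exact: gspanM|rewrite phiM].
- by exists x^-1; [exact: gspanV|rewrite gmorphV].
Qed.

Hypothesis phi_ker : forall x, phi x = 1 -> commsub setT setT x.

(** Two preimages of a point differ by an element of the kernel, hence by a product of commutators,
    on which homomorphisms to abelian groups vanish. *)
Lemma ghom_descend (M : zmodType) (f : A -> M) :
  {morph f : x y / x * y >-> (x + y)%R} ->
  exists2 f' : B -> M, {morph f' : x y / x * y >-> (x + y)%R} &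
    forall x, f' (phi x) = f x.
Proof.
move=> fM; have [s phiK] := choice phi_surj.
have fE x y : phi x = phi y -> f x = f y.
  move=> xy; rewrite -[y](mulVKg x) fM.
  rewrite (ghom_commsub fM (A := setT) (B := setT) (x := x^-1 * y)) ?addr0 //.
  by apply: phi_ker; rewrite phiM gmorphV xy mulVg.
exists (f \o s) => [x y|x] /=; last exact: fE.
by rewrite -fM; apply: fE; rewrite phiM !phiK.
Qed.

(** The product of commutators [phi x] lifts to a product of commutators [z], and [x * z^-1] lies in
    the kernel of [phi]. This serves to pass from a presentation of [G] to one of [G/G_3]. *)
Lemma ker_comp_commsub (C : groupType) (psi : B -> C) :
  (forall y, psi y = 1 -> commsub setT setT y) ->
  forall x, psi (phi x) = 1 -> commsub setT setT x.
Proof.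
move=> psi_ker x /psi_ker/commsub_lift[z Cz zx].
rewrite -[x](mulgVK z) ; apply: gspanM => //; apply: phi_ker.
by rewrite phiM gmorphV zx mulgV.
Qed.

End MorphismGroups.

Section Quotients.
Local Open Scope group_scope.
Variable G : groupType.
Implicit Types (S N : set G).

Lemma quotient_piM S : {morph @quotient_pi G S : x y / x * y}.
Proof. by move=> x y; rewrite -quotient_mulE. Qed.

Lemma quotient_pi_surj S y : exists x, @quotient_pi G S x = y.
Proof. by exists (repr y); exact: quotient_repr. Qed.

Lemma normal_closure_sub S N : normal_subgroup N ->
  (forall s, S s -> N s) -> forall x, normal_closure S x -> N x.
Proof.
move=> [N1 NM NV NJ] SN x.
elim=> {x} [x [s [g [/SN Ns ->]]]||x y _ Nx _ Ny|x _ Nx] //; first exact: NJ.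
- exact: NM.
- exact: NV.
Qed.

Lemma quotient_pi_eq1 S x : (quotient_pi S x = 1) <-> normal_closure S x.
Proof.
rewrite -(gmorph1 (@quotient_piM S)); split=> [/esym/quotient_piP/asboolP|].
  by rewrite invg1 mul1g.
by move=> Nx; apply/esym/quotient_piP/asboolP; rewrite invg1 mul1g.
Qed.

Lemma commsub_normal : normal_subgroup (@commsub G setT setT).
Proof. exact: (lower_central_normal G 2). Qed.

Lemma commsubTT A B x : @commsub G A B x -> commsub setT setT x.
Proof.
elim=> {x} [x [a [b [_ _ ->]]]||x y _ Nx _ Ny|x _ Nx].
- by apply: gspan_gen; exists a, b.
- exact: gspan1.
- exact: gspanM.
- exact: gspanV.
Qed.

End Quotients.

Section AdditiveGroup.
Variables (H : groupType) (HC : commutative (fun x y : H => x * y)%g).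

Definition additive_group of commutative (fun x y : H => x * y)%g := H.
Local Notation A := (additive_group HC).

HB.instance Definition _ := Choice.on A.
HB.instance Definition _ := GRing.isZmodule.Build A
  (@mulgA H) HC (@mul1g H) (@mulVg H).

End AdditiveGroup.

(** One test homomorphism suffices: the projection to the quotient by the commutator subgroup, read
    additively. *)
Lemma ghom_commsubP (G : groupType) (x : G) :
  (forall (M : zmodType) (f : G -> M),
     {morph f : x y / (x * y)%g >-> x + y} -> f x = 0) ->
  commsub setT setT x.
Proof.
move=> x0; pose N := @commsub G setT setT.
have QC : commutative (fun u v : group_quotient N => u * v)%g.
  move=> u v; have [[a <-] [b <-]] := (quotient_pi_surj u, quotient_pi_surj v).
  rewrite -!quotient_piM; apply/quotient_piP/asboolP.
  rewrite normal_closure_id; last exact: commsub_normal.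
  apply: gspan_gen; exists b, a; split=> //.
  by rewrite commgEl conjgE invgM !mulgA.
pose f (y : G) : additive_group QC := quotient_pi N y.
have fM : {morph f : x y / (x * y)%g >-> x + y} by exact: quotient_piM.
have /quotient_pi_eq1 := x0 _ _ fM.
by rewrite normal_closure_id //; exact: commsub_normal.
Qed.

(** * Functions on free groups *)

Section FreeGroupFunctions.
Variable X : choiceType.
Local Notation F := (free_group X).

Definition free_gen (x : X) : F := free_pi [:: (x, false)].

Lemma free_piM u v : free_pi (u ++ v) = (free_pi u * free_pi v)%g :> F.
Proof. by rewrite -free_mulE. Qed.

Lemma free_letter (x : X) b :
  free_pi [:: (x, b)] = (if b then (free_gen x)^-1 else free_gen x)%g.
Proof. by case: b => //; rewrite -[RHS]/(free_inv _) free_invE. Qed.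

Lemma free_group_ind (P : F -> Prop) :
  P 1%g -> (forall x u, P u -> P (free_gen x * u)%g) ->
  (forall x u, P u -> P ((free_gen x)^-1 * u)%g) -> forall u, P u.
Proof.
move=> P1 PM PV u; rewrite -(free_repr u).
elim: (repr u) => [//|[x b] w IHw].
by rewrite -cat1s free_piM free_letter; case: b; [exact: PV|exact: PM].
Qed.

Section Twist.
Variables (R : comNzRingType) (l w : F -> R) (a : X -> R).
Hypotheses (lM : {morph l : x y / (x * y)%g >-> x + y})
           (wM : {morph w : x y / (x * y)%g >-> x + y}).

(** The value at an inverse letter is forced: [f (x * x^-1) = 0] in the rule
    [f (u * v) = f u + f v - l u * w v] gives [- a x - l x * w x]. *)
Let letter (s : X * bool) :=
  if s.2 then - a s.1 - l (free_gen s.1) * w (free_gen s.1) else a s.1.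

Fixpoint twist_word (u : word X) : R :=
  if u is s :: v then
    letter s + twist_word v - l (free_pi [:: s]) * w (free_pi v)
  else 0.

Lemma twist_word_cat u v : twist_word (u ++ v) =
  twist_word u + twist_word v - l (free_pi u) * w (free_pi v).
Proof.
elim: u => [|s u IHu] /=.
  by rewrite -[free_pi [::]]/(1%g : F) (ghom1 lM) mul0r subr0 add0r.
rewrite IHu -(cat1s s u) !free_piM lM wM.
by ring.
Qed.

Lemma twist_word_eq u v : word_eq u v -> twist_word u = twist_word v.
Proof.
elim=> {u v} [u v x b|//|//|u v z _ -> _ ->//].
rewrite -[_ :: _]/([:: (x, b); (x, ~~ b)] ++ v) catA !twist_word_cat.
have uxx : free_pi (u ++ [:: (x, b); (x, ~~ b)]) = free_pi u.
  apply/free_piP/asboolP; rewrite -[X in word_eq _ X]cats0.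
  exact: word_eq_cancel.
rewrite uxx; congr (_ + _ - _).
have -> : free_pi [:: (x, b); (x, ~~ b)] = 1%g.
  by apply/free_piP/asboolP; exact: (word_eq_cancel [::] [::]).
rewrite (ghom1 wM) mulr0 subr0 -[RHS]addr0; congr (_ + _).
rewrite /= -[free_pi [::]]/(1%g : F) (ghom1 wM) mulr0 subr0 addr0.
rewrite !free_letter /letter /=; case: b {uxx} => /=.
- by rewrite (ghomV lM) mulNr opprK addrAC subrK addNr.
- by rewrite (ghomV wM) mulrN opprK addrA subrr add0r addNr.
Qed.

(** On a free group every cup product of characters is a coboundary, with a primitive of arbitrary
    values on the generators: an explicit case of the vanishing of second cohomology. *)
Lemma free_twist : exists2 f : F -> R,
  (forall u v, f (u * v)%g = f u + f v - l u * w v) &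
  forall x, f (free_gen x) = a x.
Proof.
exists (fun u => twist_word (repr u)) => [u v|x].
  rewrite -{3}(free_repr u) -{3}(free_repr v) -twist_word_cat.
  apply/twist_word_eq/asboolP/free_piP.
  by rewrite free_repr free_piM !free_repr.
transitivity (twist_word [:: (x, false)]); last first.
  by rewrite /= -[free_pi [::]]/(1%g : F) (ghom1 wM) mulr0 subr0 addr0.
by apply/twist_word_eq/asboolP/free_piP; rewrite free_repr.
Qed.

End Twist.

Lemma free_ghom (a : X -> int) : exists2 f : F -> int,
  {morph f : x y / (x * y)%g >-> x + y} & forall x, f (free_gen x) = a x.
Proof.
have zM : {morph (fun _ : F => 0 : int) : x y / (x * y)%g >-> x + y}.
  by move=> x y; rewrite addr0.
have [f fM fa] := free_twist a zM zM; exists f => // x y.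
by rewrite fM mul0r subr0.
Qed.

Lemma free_ghom_ext (M : zmodType) (f g : F -> M) :
  {morph f : x y / (x * y)%g >-> x + y} ->
  {morph g : x y / (x * y)%g >-> x + y} ->
  (forall x, f (free_gen x) = g (free_gen x)) -> f =1 g.
Proof.
move=> fM gM fg; apply: free_group_ind => [|x u IHu|x u IHu].
- by rewrite (ghom1 fM) (ghom1 gM).
- by rewrite fM gM fg IHu.
- by rewrite fM gM (ghomV fM) (ghomV gM) fg IHu.
Qed.

End FreeGroupFunctions.

Section FreeAbelianization.
Variable n : nat.
Local Notation F := (free_group 'I_n).

(** The [e i] are the exponent sums of the generators; the second property says that the
    abelianization is free on the generators. *)
Lemma free_exponents : exists e : 'I_n -> F -> int,
  (forall i, {morph e i : x y / (x * y)%g >-> x + y}) /\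
  forall (M : zmodType) (f : F -> M),
    {morph f : x y / (x * y)%g >-> x + y} ->
    forall u, f u = \sum_i f (free_gen i) *~ e i u.
Proof.
have /choice[e eP] : forall i : 'I_n, exists e : F -> int,
    {morph e : x y / (x * y)%g >-> x + y} /\
    forall j, e (free_gen j) = (i == j)%:Z.
  by move=> i; have [e] := free_ghom (fun j => (i == j)%:Z); exists e.
exists e; split=> [i|M f fM]; first exact: (eP i).1.
apply: free_ghom_ext => // [u v|j].
  by rewrite -big_split; apply: eq_bigr => i _; rewrite (eP i).1 mulrzDr.
rewrite (bigD1 j) //= (eP j).2 eqxx mulr1z big1 ?addr0 // => i /negPf ij.
by rewrite (eP i).2 ij mulr0z.
Qed.

End FreeAbelianization.

(** * First homology and tensor products *)

Section LinearFunctions.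
Variables (R : nzRingType) (V W : lmodType R) (L : V -> W).
Hypothesis LL : linear L.

Lemma lfun0 : L 0 = 0.
Proof. by have := LL (-1) 0 0; rewrite scaler0 addr0 scaleN1r addNr. Qed.

Lemma lfunD : {morph L : x y / x + y}.
Proof. by move=> x y; have := LL 1 x y; rewrite !scale1r. Qed.

Lemma lfunZ k : {morph L : x / k *: x}.
Proof. by move=> x; have := LL k x 0; rewrite !addr0 lfun0 addr0. Qed.

Lemma lfunB : {morph L : x y / x - y}.
Proof. by move=> x y; rewrite lfunD -scaleN1r lfunZ scaleN1r. Qed.

End LinearFunctions.

Section LinearLifts.
Variable R : nzRingType.

Lemma freeg_scale (K : choiceType) (k c : R) (x : K) :
  k *: << c *g x >> = << k * c *g x >> :> {freeg K / R}.
Proof.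
by apply/eqP/freeg_eqP => z; rewrite coeffZ !coeffU mulrA.
Qed.

Lemma fglift_linear (K : choiceType) (M : lmodType R) (f : K -> M) :
  linear (fglift f).
Proof.
have fB := lift_is_additive f.
have f0 : fglift f 0 = 0 by have := fB 0 0; rewrite !subrr.
have fD x y : fglift f (x + y) = fglift f x + fglift f y.
  by rewrite -[y in LHS]opprK fB -[- y]sub0r fB f0 sub0r opprK.
move=> k x y; rewrite fD; congr (_ + _).
elim/freeg_ind_dom0: x => [|c x D _ _ IHD].
  by rewrite !scaler0 f0 scaler0.
by rewrite scalerDr !fD IHD freeg_scale !liftU scalerDr scalerA.
Qed.

Lemma fgliftU (K : choiceType) (M : lmodType R) (f : K -> M) (x : K) :
  fglift f << x >> = f x.
Proof. by rewrite liftU scale1r. Qed.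

Section Quotient.
Variables (V : lmodType R) (S : set V).
Local Notation pi := (@lquot_pi R V S).

Lemma lquot_piD : {morph pi : x y / x + y}.
Proof. by move=> x y; rewrite -lquot_addE. Qed.

Lemma lquot_piZ k : {morph pi : x / k *: x}.
Proof. by move=> x; rewrite -lquot_scaleE. Qed.

Lemma lquot_pi0 : pi 0 = 0.
Proof. by []. Qed.

Lemma lquot_lift (W : lmodType R) (L : V -> W) :
  linear L -> (forall s, S s -> L s = 0) ->
  exists2 L' : module_quotient S -> W, linear L' & forall x, L' (pi x) = L x.
Proof.
move=> LL LS; have L0 x : lspan S x -> L x = 0.
  elim=> {x} [x /LS //||a x y _ IHx _ IHy]; first exact: (lfun0 LL).
  by rewrite LL IHx IHy scaler0 addr0.
have piE x : L (repr (pi x)) = L x.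
  by apply/eqP; rewrite -subr_eq0 -(lfunB LL); apply/eqP/L0/lspan_repr.
exists (fun u => L (repr u)) => // k u v.
rewrite -LL -[RHS]piE lquot_piD lquot_piZ !lquot_repr.
by congr (L (repr _)).
Qed.

End Quotient.

End LinearLifts.

Section FirstHomology.
Variable G : groupType.

Definition homology_class (x : G) : homology1 G :=
  lquot_pi (range (@bar_d2 G)) << x >>.

Lemma homology_classM : {morph homology_class : x y / (x * y)%g >-> x + y}.
Proof.
move=> x y; rewrite addrC -lquot_piD; apply/lquot_piP/asboolP.
rewrite -[X in lspan _ X]opprB; apply/lspanN/lspan_gen.
exists << (x, y) >> => //; rewrite /bar_d2 fgliftU.
by rewrite addrAC.
Qed.

(** Sums of classes are classes of products and integer multiples are classes of powers, so one
    group element represents any chain. *)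
Lemma homology_class_surj u : exists x, homology_class x = u.
Proof.
rewrite -(lquot_repr u); move: (repr u) => {u} c.
elim/freeg_ind_dom0: c => [|k x c _ _ [y yc]].
  by exists 1%g; rewrite lquot_pi0; exact: (ghom1 homology_classM).
suff [z zx] : exists z,
    homology_class z = lquot_pi (range (@bar_d2 G)) << k *g x >>.
  by exists (z * y)%g; rewrite homology_classM zx yc -lquot_piD.
have -> : << k *g x >> = k *: << x >> :> {freeg G / int}.
  by rewrite freeg_scale mulr1.
rewrite lquot_piZ -[lquot_pi _ _]/(homology_class x); exists (expz x k).
case: k => k; rewrite /expz.
  by rewrite (ghomX homology_classM) -[Posz k]natz scaler_nat.
by rewrite NegzE scaleNr -natz scaler_nat (ghomV homology_classM)
  (ghomX homology_classM).
Qed.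

(** The universal property of the abelianization: additivity of [f] says exactly that its linear
    extension kills the boundaries of 2-chains. *)
Lemma homology_lift (M : zmodType) (f : G -> M) :
  {morph f : x y / (x * y)%g >-> x + y} ->
  exists2 f' : homology1 G -> M, {morph f' : u v / u + v} &
    forall x, f' (homology_class x) = f x.
Proof.
move=> fM; pose g : G -> zmodule M := f.
have gL := fglift_linear g.
have dL : linear (@bar_d2 G) by exact: fglift_linear.
have g_bar_d2 y : fglift g (bar_d2 y) = 0.
  elim/freeg_ind_dom0: y => [|k [a b] D _ _ IHD].
    by rewrite (lfun0 dL) (lfun0 gL).
  have -> : << k *g (a, b) >> = k *: << (a, b) >> :> {freeg (G * G) / int}.
    by rewrite freeg_scale mulr1.
  rewrite dL gL IHD addr0 /bar_d2 fgliftU (lfunD gL) (lfunB gL) !fgliftU.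
  by rewrite /g fM addrAC [f a + f b]addrC subrr scaler0.
have [s [y _ <-]|f' f'L f'E] := lquot_lift gL (S := range (@bar_d2 G)).
  exact: g_bar_d2.
exists f' => [u v|x]; last by rewrite f'E fgliftU.
exact: (lfunD f'L).
Qed.

End FirstHomology.

Section Tensor.
Variables (A : zmodType) (F : nzRingType).

Definition tensor1 (a : A) : tensor A F :=
  lquot_pi [set t | exists a b : A, t = << a + b >> - << a >> - << b >>]
    << a >>.

Lemma tensor1D : {morph tensor1 : a b / a + b}.
Proof.
move=> a b; rewrite -lquot_piD; apply/lquot_piP/asboolP/lspan_gen.
by exists a, b; rewrite opprD addrA.
Qed.

Lemma tensor_lift (f : A -> F) : {morph f : a b / a + b} ->
  exists2 f' : tensor A F -> F^o, linear f' & forall a, f' (tensor1 a) = f a.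
Proof.
move=> fD; pose g : A -> F^o := f.
have fL := fglift_linear g.
have [_ [a [b ->]]|f' f'L f'E] := lquot_lift fL
    (S := [set t | exists a b : A, t = << a + b >> - << a >> - << b >>]).
  by rewrite !(lfunB fL) !fgliftU /g fD addrAC addrK subrr.
by exists f' => // a; rewrite f'E fgliftU.
Qed.

End Tensor.

(** Every scalar of ['F_p] is the image of a natural number and can be moved into [A], so all
    tensors are pure. *)
Lemma tensor1_surj (A : zmodType) p (u : tensor A 'F_p) :
  exists a, tensor1 'F_p a = u.
Proof.
rewrite -(lquot_repr u); move: (repr u) => {u} c.
have t10 : tensor1 'F_p 0 = 0 :> tensor A 'F_p.
  by apply: (addrI (tensor1 'F_p 0)); rewrite -tensor1D !addr0.
elim/freeg_ind_dom0: c => [|k x c _ _ [b bc]]; first by exists 0.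
exists (x *+ k + b); rewrite tensor1D bc lquot_piD; congr (_ + _).
have -> : << k *g x >> = k *: << x >> :> {freeg A / 'F_p}.
  by rewrite freeg_scale mulr1.
rewrite lquot_piZ -[lquot_pi _ _]/(tensor1 'F_p x) -{2}[k]natr_Zp scaler_nat.
by elim: (nat_of_ord k) => [//|i IHi]; rewrite !mulrS tensor1D IHi.
Qed.

(** * Dimension *)

Section Dimension.
Variable F : fieldType.

Section InSpace.
Variable V : lmodType F.
Implicit Types (W : set V).

Lemma subspace_sum W n (c : 'I_n -> F) (e : 'I_n -> V) :
  subspace W -> (forall i, W (e i)) -> W (\sum_i c i *: e i).
Proof.
move=> [W0 WP] We; apply: (big_ind W) => // [x y Wx Wy|i _].
  by rewrite -[x]scale1r; exact: WP.
by rewrite -[_ *: _]addr0; exact: WP.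
Qed.

(** If [m < k], the matrix of coordinates of the [e i] in the basis [f] has a nonzero left kernel
    vector, which is a second expansion of 0 in the basis [e]. *)
Lemma dimension_le W W' k m : W 0 -> W `<=` W' ->
  dimension W k -> dimension W' m -> (k <= m)%N.
Proof.
move=> W0 WW' [e [We eP]] [f [_ fP]]; rewrite leqNgt; apply/negP => mk.
have /choice[a aP] : forall i, exists a : {ffun 'I_m -> F},
    e i = \sum_j a j *: f j.
  by move=> i; have [a [aE _]] := fP _ (WW' _ (We i)); exists a.
pose A := \matrix_(i, j) a i j.
have /rowV0Pn[u /sub_kermxP uA /negP[]] : kermx A != 0.
  rewrite -mxrank_eq0 mxrank_ker -lt0n subn_gt0.
  exact: leq_ltn_trans (rank_leq_col A) mk.
have [c [_ c_uniq]] := eP _ W0.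
have cu : c = [ffun i => u 0 i].
  apply: c_uniq; under eq_bigr do rewrite ffunE aP scaler_sumr.
  rewrite exchange_big big1 // => j _.
  under eq_bigr do rewrite scalerA; rewrite -scaler_suml.
  have /matrixP/(_ 0 j) := uA; rewrite !mxE => uAj.
  under eq_bigr => i do [have -> : a i j = A i j by rewrite mxE].
  by rewrite uAj scale0r.
have c0 : c = [ffun=> 0].
  by apply: c_uniq; rewrite big1 // => i _; rewrite ffunE scale0r.
apply/eqP/rowP => i; move/ffunP/(_ i): cu; rewrite c0 !ffunE => <-.
by rewrite mxE.
Qed.

Lemma dimension_sub W k m : subspace W -> dimension W m -> (k <= m)%N ->
  exists W', [/\ W' `<=` W, subspace W' & dimension W' k].
Proof.
move=> Wsub [e [We eP]] km; pose f (i : 'I_k) := e (widen_ord km i).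
exists [set v | exists c : 'I_k -> F, v = \sum_i c i *: f i]; split.
- by move=> _ [c ->]; apply: subspace_sum => // i; exact: We.
- split; first by exists (fun=> 0); rewrite big1 // => i _; rewrite scale0r.
  move=> a _ _ [c ->] [b ->]; exists (fun i => a * c i + b i).
  rewrite scaler_sumr -big_split; apply: eq_bigr => i _.
  by rewrite scalerDl scalerA.
exists f; split=> [i|_ [c ->]].
  exists (fun j => (i == j)%:R).
  rewrite (bigD1 i) //= eqxx scale1r big1 ?addr0 //.
  by move=> j /negPf; rewrite eq_sym => ->; rewrite scale0r.
exists [ffun i => c i]; split=> [|b].
  by under [RHS]eq_bigr do rewrite ffunE.
pose ext (b : 'I_k -> F) := [ffun i : 'I_m => oapp b 0 (insub (val i))].
have extE b' : \sum_i b' i *: f i = \sum_i ext b' i *: e i.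
  rewrite [RHS](bigID (fun i : 'I_m => (i < k)%N)) /= [X in _ + X]big1 ?addr0.
    rewrite (big_ord_narrow km); apply: eq_bigr => i _.
    by rewrite ffunE /= insubT //= => ik; congr (b' _ *: _); exact/val_inj.
  by move=> i ik; rewrite ffunE insubN // scale0r.
rewrite !extE => cb.
have [c' [_ c'_uniq]] := eP _ (subspace_sum (ext c) Wsub We).
have ecb : ext c = ext b by rewrite -(c'_uniq _ erefl) (c'_uniq _ cb).
apply/ffunP => i; rewrite ffunE.
move/ffunP/(_ (widen_ord km i)): ecb; rewrite !ffunE /= insubT //= => ik.
by rewrite (_ : Sub _ _ = i) //; exact/val_inj.
Qed.

Lemma dimension_extend W (ev : V -> F^o) (v0 : V) m :
  subspace W -> linear ev -> W v0 -> ev v0 = 1 ->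
  dimension (W `&` [set v | ev v = 0]) m -> dimension W m.+1.
Proof.
move=> Wsub evL Wv0 ev0 [e [We eP]]; have [W0 WP] := Wsub.
pose e' i := oapp e v0 (unlift ord0 i).
have e'0 : e' ord0 = v0 by rewrite /e' unlift_none.
have e'S i : e' (lift ord0 i) = e i by rewrite /e' liftK.
have sumE (c : 'I_m.+1 -> F) : \sum_i c i *: e' i =
    c ord0 *: v0 + \sum_i c (lift ord0 i) *: e i.
  rewrite big_ord_recl e'0; congr (_ + _).
  by apply: eq_bigr => i _; rewrite e'S.
have ev_sum (c : 'I_m -> F) : ev (\sum_i c i *: e i) = 0.
  have Zsub : subspace (W `&` [set v | ev v = 0]).
    split; first by split=> //; exact: (lfun0 evL).
    move=> a x y [Wx evx] [Wy evy]; split; first exact: WP.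
    by rewrite /= evL evx evy scaler0 addr0.
  by have [] := subspace_sum c Zsub We.
exists e'; split=> [i|v Wv].
  by rewrite /e'; case: (unlift _ _) => //= j; have [] := We j.
have Wv' : (W `&` [set v | ev v = 0]) (v - ev v *: v0).
  split; first by rewrite addrC -scaleNr; exact: WP.
  by rewrite /= (lfunB evL) (lfunZ evL) ev0 [_ *: 1]mulr1 subrr.
have [c [cE c_uniq]] := eP _ Wv'.
exists [ffun i => oapp c (ev v) (unlift ord0 i)]; split.
  rewrite sumE ffunE unlift_none /=.
  under eq_bigr do rewrite ffunE liftK.
  by rewrite -cE addrC subrK.
move=> b; rewrite sumE => vE.
have evv : ev v = b ord0.
  by rewrite vE (lfunD evL) (lfunZ evL) ev0 ev_sum addr0 [_ *: 1]mulr1.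
have cb : c = [ffun i => b (lift ord0 i)].
  apply: c_uniq; under eq_bigr do rewrite ffunE.
  by rewrite evv vE addrAC subrr add0r.
apply/ffunP => i; rewrite ffunE.
case: unliftP => [j ->|->] //=.
by rewrite cb ffunE.
Qed.

(** Induction on the spanning family: unless it is a basis, two expansions of one vector express
    some member by the others, and the others still span. *)
Lemma dimension_span n (v : 'I_n -> V) :
  (forall x, exists c : 'I_n -> F, x = \sum_i c i *: v i) ->
  exists d, dimension [set: V] d.
Proof.
elim: n v => [|n IHn] v vP.
  exists 0%N; exists v; split=> // x _; have [c ->] := vP x.
  exists [ffun i => c i]; split=> [|b _]; first by rewrite !big_ord0.
  by apply/ffunP => -[].
have [v_free|] := pselect (forall x, exists! c : {ffun 'I_n.+1 -> F},
    x = \sum_i c i *: v i).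
  by exists n.+1, v; split.
move=> /existsNP[x xP].
suff [j [a aE]] : exists j, exists a : 'I_n -> F,
    v j = \sum_i a i *: v (lift j i).
  apply: (IHn (fun i => v (lift j i))) => y; have [c ->] := vP y.
  exists (fun i => c j * a i + c (lift j i)).
  rewrite (bigD1_ord j) //= {1}aE scaler_sumr -big_split.
  by apply: eq_bigr => i _; rewrite scalerDl scalerA.
apply: contrapT => v_indep; apply: xP; have [c cE] := vP x.
exists [ffun i => c i]; split=> [|b bE].
  by under eq_bigr do rewrite ffunE.
apply/ffunP => j; rewrite ffunE; apply: contrapT => /eqP cb; apply: v_indep.
rewrite -subr_eq0 in cb; exists j.
(* The two expansions [b] and [c] of [x] are equated and solved for [v j], where [c j - b j] is
   nonzero. *)
exists (fun i => (b (lift j i) - c (lift j i)) / (c j - b j)).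
apply: (scalerI cb); rewrite scaler_sumr.
under eq_bigr do rewrite scalerA mulrCA mulfV // mulr1 scalerBl.
rewrite sumrB scalerBl; apply/eqP.
rewrite subr_eq addrAC eq_sym subr_eq; apply/eqP.
rewrite (bigD1_ord j) //= in cE; rewrite (bigD1_ord j) //= in bE.
by rewrite -cE addrC -bE.
Qed.

End InSpace.

(* The coordinate functions of a basis of V, composed with c, are a basis of  *)
(* A.                                                                         *)
Lemma dimension_dual (V : lmodType F) (X : Type) (c : X -> V)
    (A : set (X -> F^o)) d :
  (forall v, exists x, c x = v) ->
  (forall psi : V -> F^o, linear psi -> A (psi \o c)) ->
  (forall w, A w -> exists2 psi : V -> F^o, linear psi & w = psi \o c) ->
  dimension [set: V] d -> dimension A d.
Proof.
move=> c_surj psiA Apsi [e [_ eP]].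
have /choice[co coP] v := eP v I.
have coE v : \sum_i co v i *: e i = v by have [<-] := coP v.
have coU v b : v = \sum_i b i *: e i -> co v =1 b.
  move=> vE i.
  have [_ /(_ [ffun i => b i]) ->] := coP v; first by rewrite ffunE.
  by under eq_bigr do rewrite ffunE.
have coL i : linear (co^~ i : V -> F^o).
  move=> k x y; apply: (coU _ (fun i => k * co x i + co y i)).
  under eq_bigr do rewrite scalerDl -scalerA.
  by rewrite big_split /= -scaler_sumr !coE.
exists (fun i x => co (c x) i); split=> [i|w /Apsi[psi psiL ->]].
  exact: (psiA _ (coL i)).
have sumE (b : 'I_d -> F) x : (\sum_i b i *: (fun x => co (c x) i : F^o)) x =
    \sum_i b i * co (c x) i.
  by rewrite fct_sumE.
exists [ffun i => psi (e i)]; split=> [|b bE].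
  apply/funext => x; rewrite sumE /= -[in LHS](coE (c x)).
  rewrite (big_morph psi (lfunD psiL) (lfun0 psiL)).
  by apply: eq_bigr => i _; rewrite (lfunZ psiL) ffunE mulrC.
apply/ffunP => i; rewrite ffunE; have [x xE] := c_surj (e i).
have := congr1 (@^~ x) bE; rewrite /= sumE xE => ->.
have coi : co (e i) =1 (fun j => (i == j)%:R).
  apply: coU; rewrite (bigD1 i) //= eqxx scale1r big1 ?addr0 // => j /negPf.
  by rewrite eq_sym => ->; rewrite scale0r.
rewrite (bigD1 i) //= coi eqxx mulr1 big1 ?addr0 // => j /negPf.
by rewrite coi eq_sym => ->; rewrite mulr0.
Qed.

End Dimension.

(** * Torsion in the homology of the kernel of a character *)

Section CentralCommutators.
Local Open Scope group_scope.
Variable Q : groupType.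
Hypothesis Qcentral : forall a b c : Q, commute [~ a, b] c.

Lemma commMl (a b c : Q) : [~ a * b, c] = [~ a, c] * [~ b, c].
Proof.
have -> : [~ a * b, c] = [~ a, c] ^ b * [~ b, c].
  by rewrite !commgEl conjMg invgM [X in _ = X * _]conjgE !mulgA !mulgK.
by congr (_ * _); apply/conjg_fixP/commgP.
Qed.

Lemma commMr (a b c : Q) : [~ a, b * c] = [~ a, b] * [~ a, c].
Proof. by rewrite -invgR commMl invgM !invgR; exact: Qcentral. Qed.

Lemma commXX (a b : Q) i j : [~ a ^+ i, b ^+ j] = [~ a, b] ^+ (i * j).
Proof.
have Xl (x y : Q) k : [~ x ^+ k, y] = [~ x, y] ^+ k.
  elim: k => [|k IHk]; first by rewrite !expg0 comm1g.
  by rewrite !expgS commMl IHk.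
have Xr (x y : Q) k : [~ x, y ^+ k] = [~ x, y] ^+ k.
  by rewrite -invgR Xl -expVgn invgR.
by rewrite Xl Xr -expgnA mulnC.
Qed.

End CentralCommutators.

Section Torsion.
Variable A : lmodType int.

(** [Tors] is formed from the span of the torsion elements; this shows that the span adds
    nothing. *)
Lemma lspan_torsion x : lspan (@torsion A) x -> torsion x.
Proof.
elim=> {x} [//||a x y _ [k [k0 kx]] _ [m [m0 my]]].
  by exists 1; rewrite scale1r.
exists (k * m); split; first by rewrite mulf_neq0.
have -> : (k * m) *: (a *: x + y) = (m * a) *: (k *: x) + k *: (m *: y).
  by rewrite scalerDr !scalerA; congr (_ *: _ + _); ring.
by rewrite kx my !scaler0 addr0.
Qed.

Lemma torsionD (x y : A) : torsion x -> torsion y -> torsion (x + y).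
Proof. by move=> tx ty; apply/lspan_torsion/lspanD; exact: lspan_gen. Qed.

End Torsion.

Section KernelHomology.
Variables (Q : groupType) (p : nat) (lam : Q -> 'F_p).
Hypotheses (p_pr : prime p) (lamM : {morph lam : x y / (x * y)%g >-> x + y}).
Hypothesis Qcentral : forall a b c : Q, commute [~ a, b]%g c.

Definition ghom_ker : set Q := [set q | lam q = 0].
Local Notation K := ghom_ker.
Local Notation KT := (subgroup_type K).
Local Notation T := (Tors (homology1 KT)).

Lemma ghom_ker_normal : normal_subgroup K.
Proof.
rewrite /K; split=> [|x y /= Kx Ky|x /= Kx|x g /= Kx].
- exact: (ghom1 lamM).
- by rewrite lamM Kx Ky addr0.
- by rewrite (ghomV lamM) Kx oppr0.
- by rewrite conjgE !lamM (ghomV lamM) Kx add0r addNr.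
Qed.

Lemma in_gspan_ker q : (q \in in_gspan K) <-> K q.
Proof.
split=> [/asboolP|Kq]; last exact/asboolP/gspan_gen.
have [K1 KM KV _] := ghom_ker_normal.
by elim=> {q} [//|//|x y _ Kx _ Ky|x _ Kx]; [exact: KM|exact: KV].
Qed.

(** A total function on [Q]: outside the kernel it takes the class of 1, so its additivity is stated
    inside the kernel. *)
Definition ker_class (q : Q) : homology1 KT :=
  homology_class (insubd (1%g : KT) q).

Lemma ker_classM a b : K a -> K b ->
  ker_class (a * b)%g = ker_class a + ker_class b.
Proof.
move=> Ka Kb; rewrite -homology_classM; congr homology_class; apply: val_inj.
have [_ KM _ _] := ghom_ker_normal.
by rewrite valM !insubdK //; apply/in_gspan_ker => //; exact: KM.
Qed.

Lemma ker_class_val (x : KT) : ker_class (val x) = homology_class x.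
Proof. by rewrite /ker_class valKd. Qed.

(** This turns out to be the commutator subgroup of [Q]: [commsub_tors_ker] and [tors_ker_commsub]
    give the two inclusions. *)
Definition tors_ker : set Q := [set q | K q /\ torsion (ker_class q)].
Definition tors_class (q : Q) : T := insubd (0 : T) (ker_class q).

Lemma val_tors_class q : tors_ker q -> val (tors_class q) = ker_class q.
Proof. by move=> [_ tq]; apply/insubdK/asboolP/lspan_gen. Qed.

Lemma tors_kerM a b : tors_ker a -> tors_ker b -> tors_ker (a * b)%g.
Proof.
move=> [Ka ta] [Kb tb]; have [_ KM _ _] := ghom_ker_normal.
by split; [exact: KM|rewrite ker_classM //; exact: torsionD].
Qed.

Lemma tors_classM a b : tors_ker a -> tors_ker b ->
  tors_class (a * b)%g = tors_class a + tors_class b.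
Proof.
move=> ta tb; apply: val_inj; rewrite val_tors_class; last exact: tors_kerM.
rewrite ker_classM; [|exact: ta.1|exact: tb.1].
by rewrite raddfD -(val_tors_class ta) -(val_tors_class tb).
Qed.

Lemma ker_class1 : ker_class 1%g = 0.
Proof. by rewrite -(val1 KT) ker_class_val (ghom1 (@homology_classM KT)). Qed.

Lemma tors_ker1 : tors_ker 1%g.
Proof.
by split; [exact: (ghom1 lamM)|rewrite ker_class1; exists 1; rewrite scaler0].
Qed.

Lemma tors_kerV a : tors_ker a -> tors_ker a^-1%g.
Proof.
move=> [Ka [m [m0 ma]]]; have [_ _ KV _] := ghom_ker_normal.
split; first exact: KV.
exists m; split=> //.
have : ker_class (a * a^-1)%g = 0 by rewrite mulgV ker_class1.
rewrite ker_classM //; last exact: KV.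
move/eqP; rewrite addr_eq0 => /eqP aV.
by apply: oppr_inj; rewrite -scalerN -aV ma oppr0.
Qed.

Lemma ker_classR k l : K k -> K l -> ker_class [~ k, l]%g = 0.
Proof.
move=> /in_gspan_ker Kk /in_gspan_ker Kl.
rewrite -[k](insubdK (1%g : KT) Kk) -[l](insubdK (1%g : KT) Kl).
by rewrite -gmorphR ?ker_class_val ?(ghomR (@homology_classM KT)).
Qed.

Lemma ker_classX a k : K a -> ker_class (a ^+ k)%g = ker_class a *+ k.
Proof.
move=> Ka; have [K1 KM _ _] := ghom_ker_normal.
have KX i : K (a ^+ i)%g.
  by elim: i => [|i IHi]; rewrite ?expg0 // expgS; exact: KM.
by elim: k => [|k IHk]; rewrite ?ker_class1 // expgS ker_classM // IHk mulrS.
Qed.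

Lemma Fp_mulrn_p (x : 'F_p) : x *+ p = 0.
Proof. by rewrite -mulr_natr (pcharf0 (pchar_Fp p_pr)) mulr0. Qed.

Lemma ghom_kerX a : K (a ^+ p)%g.
Proof. by rewrite /K /= (ghomX lamM) Fp_mulrn_p. Qed.

(** By bilinearity, [p * p] times the class of [[a, b]] is the class of [[a^p, b^p]], and p-th
    powers lie in the kernel, whose own commutators are null in its homology. *)
Lemma tors_kerR a b : tors_ker [~ a, b]%g.
Proof.
have KR : K [~ a, b]%g by rewrite /K /= (ghomR lamM).
split=> //; exists (p * p)%N%:Z; split.
  by have := prime_gt0 p_pr; case: (p).
rewrite -natz scaler_nat -ker_classX // -(commXX Qcentral).
by rewrite ker_classR //; exact: ghom_kerX.
Qed.

Lemma tors_classRK k l : K k -> K l -> tors_class [~ k, l]%g = 0.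
Proof.
move=> Kk Kl; apply: val_inj; rewrite val_tors_class; last exact: tors_kerR.
by rewrite ker_classR // raddf0.
Qed.

Lemma commsub_tors_ker q : commsub setT setT q -> tors_ker q.
Proof.
elim=> {q} [q [a [b [_ _ ->]]]||x y _ IHx _ IHy|x _ IHx].
- exact: tors_kerR.
- exact: tors_ker1.
- exact: tors_kerM.
- exact: tors_kerV.
Qed.

(** The restriction of [f] to the kernel factors through [H_1]. Additivity on all of [Q] would be
    too much to ask of a cochain whose coboundary is a cup product with [lam]. *)
Lemma tors_functional (f : Q -> 'F_p) :
  (forall a b, K a -> K b -> f (a * b)%g = f a + f b) ->
  exists2 f' : T -> 'F_p, {morph f' : s t / s + t} &
    forall q, tors_ker q -> f' (tors_class q) = f q.
Proof.
move=> fM; pose g (x : KT) := f (val x).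
have gM : {morph g : x y / (x * y)%g >-> x + y}.
  by move=> x y; rewrite /g valM fM //; apply/in_gspan_ker/valP.
have [g' g'D g'E] := homology_lift gM.
exists (g' \o val) => [s t|q tq]; first by rewrite /= -g'D.
transitivity (g' (ker_class q)); first by congr g'; exact: val_tors_class.
by rewrite g'E /g insubdK //; apply/in_gspan_ker; exact: tq.1.
Qed.

Hypothesis Qab_torsion_free : forall q : Q,
  (forall f : Q -> int, {morph f : x y / (x * y)%g >-> x + y} -> f q = 0) ->
  commsub setT setT q.

(** A homomorphism [f] from [Q] to the integers, restricted to the kernel, factors through its
    [H_1]; so [m * f q = 0] and hence [f q = 0]. *)
Lemma tors_ker_commsub q : tors_ker q -> commsub setT setT q.
Proof.
move=> [Kq [m [m0 mq]]]; apply: Qab_torsion_free => f fM.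
pose g (x : KT) := f (val x).
have gM : {morph g : x y / (x * y)%g >-> x + y}.
  by move=> x y; rewrite /g valM fM.
have [g' g'D g'E] := homology_lift gM.
have g'M : {morph (g' : homology1 KT -> int) : x y / x + y} := g'D.
have g'0 : g' 0 = 0 by apply: (addrI (g' 0)); rewrite -g'D !addr0.
have g'N x : g' (- x) = - g' x.
  by apply: (addrI (g' x)); rewrite -g'D !subrr.
have g'X x k : g' (x *+ k) = g' x *+ k.
  by elim: k => [//|k IHk]; rewrite !mulrS g'D IHk.
have g'Z x k : g' (k *: x) = k * g' x.
  case: k => k; first by rewrite -natz scaler_nat g'X mulr_natl.
  by rewrite NegzE -natz scaleNr scaler_nat g'N g'X mulNr mulr_natl.
have := g'Z (ker_class q) m.
rewrite mq g'0 g'E /g insubdK; last exact/in_gspan_ker.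
by move/esym/eqP; rewrite mulf_eq0 (negPf m0) => /eqP.
Qed.

Lemma tors_class_surj t : exists2 q, commsub setT setT q & tors_class q = t.
Proof.
have [x xt] := homology_class_surj (val t).
have tx : tors_ker (val x).
  split; first exact/in_gspan_ker/valP.
  rewrite ker_class_val xt; apply: lspan_torsion.
  by have /asboolP := valP t.
exists (val x); first exact: tors_ker_commsub.
by apply: val_inj; rewrite val_tors_class // ker_class_val.
Qed.

End KernelHomology.

(** * The commutator pairing with values in [T] tensored with ['F_p] *)

Section CommutatorPairing.
Variables (Q : groupType) (p : nat) (lam : Q -> 'F_p) (g0 : Q).
Hypotheses (lamM : {morph lam : x y / (x * y)%g >-> x + y})
           (lam_g0 : lam g0 = 1).
Hypothesis Qcentral : forall a b c : Q, commute [~ a, b]%g c.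
Local Notation K := (ghom_ker lam).

Variables (T : zmodType) (tau : Q -> T).
Hypothesis tauM : forall a b, commsub setT setT a -> commsub setT setT b ->
  tau (a * b)%g = tau a + tau b.
Hypothesis tauRK : forall k l, K k -> K l -> tau [~ k, l]%g = 0.
Hypothesis tau_surj : forall t, exists2 q, commsub setT setT q & tau q = t.

Local Notation V := (tensor T 'F_p).

Definition tau_tensor (q : Q) : V := tensor1 'F_p (tau q).
Local Notation theta := tau_tensor.

Lemma commsubR (H : groupType) (a b : H) : commsub setT setT [~ a, b]%g.
Proof. by apply: gspan_gen; exists a, b. Qed.

Lemma tau_tensorM a b : commsub setT setT a -> commsub setT setT b ->
  theta (a * b)%g = theta a + theta b.
Proof. by move=> Ca Cb; rewrite /theta tauM // tensor1D. Qed.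

Lemma tau_tensor1 : theta 1%g = 0.
Proof.
apply: (addrI (theta 1%g)); rewrite -tau_tensorM ?mulg1 ?addr0 //;
  exact: gspan1.
Qed.

Lemma tau_tensorV a : commsub setT setT a -> theta a^-1%g = - theta a.
Proof.
move=> Ca; apply: (addrI (theta a)); rewrite subrr -tau_tensorM //.
  by rewrite mulgV tau_tensor1.
exact: gspanV.
Qed.

Lemma tau_tensorRl a b c :
  theta [~ a * b, c]%g = theta [~ a, c]%g + theta [~ b, c]%g.
Proof. by rewrite commMl // tau_tensorM //; exact: commsubR. Qed.

Lemma tau_tensorRr a b c :
  theta [~ a, b * c]%g = theta [~ a, b]%g + theta [~ a, c]%g.
Proof. by rewrite commMr // tau_tensorM //; exact: commsubR. Qed.

Let c (q : Q) : V := theta [~ g0, q]%g.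

Let cM : {morph c : x y / (x * y)%g >-> x + y}.
Proof. by move=> x y; exact: tau_tensorRr. Qed.

Lemma ghom_ker_decomp a : exists2 k, K k & a = (g0 ^+ (lam a) * k)%g.
Proof.
exists (g0 ^- (lam a) * a)%g; last by rewrite mulgA mulgV mul1g.
by rewrite /K /= lamM (ghomV lamM) (ghomX lamM) lam_g0 natr_Zp addNr.
Qed.

Lemma tau_tensorR a b : theta [~ a, b]%g =
  lam a *: theta [~ g0, b]%g - lam b *: theta [~ g0, a]%g.
Proof.
have scE (r : 'F_p) (v : V) : v *+ r = r *: v by rewrite -scaler_nat natr_Zp.
have cX x k : theta [~ g0 ^+ k, x]%g = c x *+ k.
  elim: k => [|k IHk]; first by rewrite expg0 comm1g tau_tensor1.
  by rewrite expgS tau_tensorRl IHk mulrS.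
have cXr x k : theta [~ x, g0 ^+ k]%g = - (c x *+ k).
  by rewrite -invgR tau_tensorV ?cX //; exact: commsubR.
have [k Kk aE] := ghom_ker_decomp a; have [l Kl bE] := ghom_ker_decomp b.
have kl0 : theta [~ k, l]%g = 0.
  (* The zero of [T] is recognized as [tau 1] by writing it as [tau [k, k]]. *)
  by rewrite -tau_tensor1 /theta tauRK // -(tauRK Kk Kk) commgg.
(* Expanding [a] splits off [lam a *: c b]. What remains is [theta [k, b]], and [c k = c a] because
   [c] kills the powers of [g0]. *)
rewrite [in LHS]aE tau_tensorRl cX scE; congr (_ + _).
rewrite [in LHS]bE tau_tensorRr cXr kl0 addr0 scE.
have cg0 : c g0 = 0 by rewrite /c commgg tau_tensor1.
have cg0X i : c (g0 ^+ i)%g = 0 by rewrite (ghomX cM) cg0 mul0rn.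
by rewrite -/(c a) [in RHS]aE cM cg0X add0r.
Qed.

Lemma tau_tensor_surj v : exists q, theta [~ g0, q]%g = v.
Proof.
have [t <-] := tensor1_surj v; have [q Cq <-] := tau_surj t.
rewrite -/(theta q).
elim: Cq => {q} [q [a [b [_ _ ->]]]||x y Cx [i ix] Cy [j jy]|x Cx [i ix]].
(* By additivity, [c] at this product is the right side of [tau_tensorR]. *)
- exists (b ^+ lam a * a ^- lam b)%g; rewrite -/(c _) cM (ghomV cM) !(ghomX cM).
  by rewrite tau_tensorR -!scaler_nat !natr_Zp.
- by exists g0; rewrite commgg.
- by exists (i * j)%g; rewrite -/(c _) cM /c ix jy tau_tensorM.
- by exists i^-1%g; rewrite -/(c _) (ghomV cM) /c ix tau_tensorV.
Qed.

End CommutatorPairing.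

(** * Cup products and resonance *)

Section TwistedHom.
Variables (G : groupType) (R : comNzRingType) (l w f : G -> R).
Hypotheses (lM : {morph l : x y / (x * y)%g >-> x + y})
           (wM : {morph w : x y / (x * y)%g >-> x + y})
           (fM : forall x y, f (x * y)%g = f x + f y - l x * w y).

Lemma twist1 : f 1%g = 0.
Proof.
have := fM 1%g 1%g; rewrite (ghom1 lM) mul0r subr0 mulg1 => f1.
by apply: (addrI (f 1%g)); rewrite addr0 -f1.
Qed.

(** Expand [f] on both sides of [x y = y x [x, y]]; the twisting term at [[x, y]] drops because [w]
    kills commutators. *)
Lemma twistR x y : f [~ x, y]%g = l y * w x - l x * w y.
Proof.
have := fM (y * x)%g [~ x, y]%g.
rewrite -commgC !fM (ghomR wM) mulr0 subr0 => E.
apply: (addrI (f y + f x - l y * w x)); rewrite -E; ring.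
Qed.

Lemma twistM_commsub x y : commsub setT setT y -> f (x * y)%g = f x + f y.
Proof. by move=> Cy; rewrite fM (ghom_commsub wM Cy) mulr0 subr0. Qed.

Lemma twistV_commsub x : commsub setT setT x -> f x^-1%g = - f x.
Proof.
move=> Cx; apply: (addrI (f x)).
rewrite subrr -twistM_commsub ?mulgV ?twist1 //.
exact: gspanV.
Qed.

(** By [twistR], [f] kills a commutator with an entry in [G_2], where [l] and [w] vanish; and [f] is
    additive on [G_2]. *)
Lemma twist_lower_central3 x : lower_central G 3 x -> f x = 0.
Proof.
elim=> {x} [x [a [b [_ Cb ->]]]||x y _ IHx Cy IHy|x Cx IHx].
- by rewrite twistR (ghom_commsub lM Cb) (ghom_commsub wM Cb) mul0r mulr0 subrr.
- exact: twist1.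
- by rewrite twistM_commsub ?IHx ?IHy ?addr0 //; exact: commsubTT Cy.
- by rewrite twistV_commsub ?IHx ?oppr0 //; exact: commsubTT Cx.
Qed.

End TwistedHom.

Definition tors_dimension (Q : groupType) (p : nat) (K : set Q) (d : nat) :=
  dimension [set: tensor (Tors (homology1 (subgroup_type K))) 'F_p] d.

(* Used instead of unfolding nu_set for a concrete Q, where the canonical     *)
(* structures of the tensor product are expensive to compare.                 *)
Lemma nu_setP (Q : groupType) (p d : nat) (K : set Q) :
  nu_set p d Q K <-> [/\ normal_subgroup K, (left_cosets K #= `I_p)%card &
    tors_dimension p K d].
Proof. by []. Qed.

(** * Groups presented by commutator relators and their quotient [G/G_3] *)

Section Presented.
Variables (G : groupType) (n p : nat) (rho : free_group 'I_n -> G).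
Hypotheses (rhoM : {morph rho : x y / (x * y)%g})
           (rho_surj : forall x, exists u, rho u = x)
           (rho_ker : forall u, rho u = 1%g -> commsub setT setT u).

(** The cup product has a primitive on the free group. On products of commutators it equals [phi]
    after [rho], so it vanishes on the kernel of [rho] and descends to [G]. *)
Lemma cup_coboundary (l w : G -> ('F_p)^o) (phi : G -> 'F_p) :
  cohomology1 G p l -> cohomology1 G p w -> phi 1%g = 0 ->
  (forall x y, commsub setT setT x -> commsub setT setT y ->
     phi (x * y)%g = phi x + phi y) ->
  (forall a b, phi [~ a, b]%g = l b * w a - l a * w b) ->
  coboundaries2 (cup l w).
Proof.
move=> lM wM phi1 phiM phiR.
pose l' := (l \o rho : free_group 'I_n -> 'F_p).
pose w' := (w \o rho : free_group 'I_n -> 'F_p).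
have l'M : {morph l' : x y / (x * y)%g >-> x + y}.
  by move=> x y; rewrite /l' /= rhoM lM.
have w'M : {morph w' : x y / (x * y)%g >-> x + y}.
  by move=> x y; rewrite /w' /= rhoM wM.
have [f fM _] := free_twist (fun=> 0) l'M w'M.
have fphi u : commsub setT setT u -> f u = phi (rho u).
  elim=> {u} [u [a [b [_ _ ->]]]||u v Cu IHu Cv IHv|u Cu IHu].
  - by rewrite (twistR w'M fM) gmorphR // phiR.
  - by rewrite (twist1 l'M fM) gmorph1.
  - rewrite (twistM_commsub w'M fM) // IHu IHv rhoM phiM //;
      exact: (gmorph_commsub rhoM).
  - rewrite (twistV_commsub l'M w'M fM) // IHu gmorphV //.
    have Cr := gmorph_commsub rhoM Cu.
    apply: (addrI (phi (rho u))); rewrite subrr -phiM ?mulgV ?phi1 //.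
    exact: gspanV.
have f_rho u v : rho u = rho v -> f u = f v.
  move=> uv; have r1 : rho (u^-1 * v)%g = 1%g.
    by rewrite rhoM gmorphV // uv mulVg.
  rewrite -[v](mulVKg u) (twistM_commsub w'M fM); last exact: rho_ker.
  by rewrite (fphi (u^-1 * v)%g) ?r1 ?phi1 ?addr0 //; exact: rho_ker.
have [s sK] := choice rho_surj.
exists (f \o s) => x y /=.
have -> : f (s (x * y)%g) = f (s x * s y)%g by apply: f_rho; rewrite rhoM !sK.
rewrite fM /l' /w' /= !sK /cup; ring.
Qed.

Local Notation Q := (group_quotient (lower_central G 3)).
Local Notation pi := (quotient_pi (lower_central G 3)).
Let piM : {morph pi : x y / (x * y)%g} := @quotient_piM G _.
Let pi_surj y : exists x, pi x = y := quotient_pi_surj y.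

Lemma pi_eq1 x : pi x = 1%g <-> lower_central G 3 x.
Proof.
by rewrite quotient_pi_eq1 normal_closure_id //; exact: lower_central_normal.
Qed.

Lemma pi_ker x : pi x = 1%g -> commsub setT setT x.
Proof. by move/pi_eq1; exact: commsubTT. Qed.

Lemma quotient3_central (a b c : Q) : commute [~ a, b]%g c.
Proof.
have [[a' <-] [b' <-] [c' <-]] := And3 (pi_surj a) (pi_surj b) (pi_surj c).
apply/commgP/eqP; rewrite -(gmorphR piM a' b') -(gmorphR piM _ c').
apply/pi_eq1.
(* [G_3] is generated by commutators with the element of [G_2] in second place, hence the
   inversion. *)
rewrite -invgR; apply/gspanV/gspan_gen; exists c', [~ a', b']%g; split=> //.
by apply: gspan_gen; exists a', b'.
Qed.

(** Exponent sums descend from the free group to [Q], since only products of commutators are killed.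
    If all integral homomorphisms kill [q], a word representing [q] has exponent sums 0 and is
    itself a product of commutators. *)
Lemma quotient3_torsion_free (q : Q) :
  (forall f : Q -> int, {morph f : x y / (x * y)%g >-> x + y} -> f q = 0) ->
  commsub setT setT q.
Proof.
move=> q0; have [e [eM eP]] := free_exponents n.
have [x xq] := pi_surj q; have [u ux] := rho_surj x.
pose sigma := (pi \o rho).
have sM : {morph sigma : x y / (x * y)%g}.
  by move=> a b; rewrite /sigma /= rhoM piM.
have s_surj y : exists u, sigma u = y.
  by have [a <-] := pi_surj y; have [b <-] := rho_surj a; exists b.
have s_ker := ker_comp_commsub rhoM rho_surj rho_ker pi_ker.
have uq : sigma u = q by rewrite /sigma /= ux.
rewrite -uq; apply: (gmorph_commsub sM).
apply: ghom_commsubP => M f /eP ->; apply: big1 => i _.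
have [e' e'M e'E] := ghom_descend sM s_surj s_ker (eM i).
by rewrite -e'E uq q0 // mulr0z.
Qed.

Definition cup_annihilator (m : G -> ('F_p)^o) : set (G -> ('F_p)^o) :=
  [set w | cohomology1 G p w /\ coboundaries2 (cup m w)].

Lemma subspace_cup_annihilator m : subspace (cup_annihilator m).
Proof.
split=> [|a x y [xM [f fE]] [yM [g gE]]].
  split; first by move=> a b; rewrite addr0.
  by exists (fun=> 0) => a b; rewrite /cup mulr0 subrr addr0.
split=> [b b'|].
  by rewrite !fctE xM yM scalerDr addrACA.
exists (fun b => a * f b + g b) => b b'; rewrite /cup !fctE.
have := fE b b'; have := gE b b'; rewrite /cup => gE' fE'.
rewrite [a *: _]/(a * _) mulrDr mulrCA fE' gE'; ring.
Qed.

(** An admissible [W] is a subspace of the annihilator of dimension [d + 1], and one exists exactly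
    when [d + 1 <= D + 1]. *)
Lemma resonanceP d D (l : G -> ('F_p)^o) : cohomology1 G p l ->
  dimension (cup_annihilator l) D.+1 -> resonance G p d l <-> (d <= D)%N.
Proof.
move=> lM annD; split=> [[_ [W [W1 [W0 WP] Wd Wcup]]]|dD].
  rewrite -ltnS; apply: dimension_le Wd annD => //.
  by move=> w Ww; split; [exact: W1|exact: Wcup].
have [W [Wann Wsub Wd]] :=
  dimension_sub (subspace_cup_annihilator l) annD (dD : (d.+1 <= D.+1)%N).
by split=> //; exists W; split=> // w /Wann[].
Qed.

(** * The annihilator of a character through the dual of an abstract coefficient space *)

Section Character.
Variables (lam : Q -> 'F_p) (g0 : G) (V : lmodType 'F_p) (theta : Q -> V).
Hypotheses (lamM : {morph lam : x y / (x * y)%g >-> x + y})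
           (lam_g0 : lam (pi g0) = 1).
Hypothesis thetaM : forall a b, commsub setT setT a -> commsub setT setT b ->
  theta (a * b)%g = theta a + theta b.
Hypothesis thetaR : forall a b, theta [~ a, b]%g =
  lam a *: theta [~ pi g0, b]%g - lam b *: theta [~ pi g0, a]%g.
Hypothesis theta_surj : forall v, exists q, theta [~ pi g0, q]%g = v.
Hypothesis theta_functional : forall f : Q -> 'F_p,
  (forall a b, ghom_ker lam a -> ghom_ker lam b -> f (a * b)%g = f a + f b) ->
  exists2 psi : V -> ('F_p)^o, linear psi &
    forall q, commsub setT setT q -> psi (theta q) = f q.

Let l : G -> ('F_p)^o := lam \o pi.
Let c (x : G) : V := theta [~ pi g0, pi x]%g.

Let lM : cohomology1 G p l.
Proof. by move=> x y; rewrite /l /= piM lamM. Qed.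

Let theta1 : theta 1%g = 0.
Proof. by rewrite -(commgg (pi g0)) thetaR subrr. Qed.

Let cM : {morph c : x y / (x * y)%g >-> x + y}.
Proof.
move=> x y; rewrite /c piM (commMr quotient3_central) thetaM //;
  exact: commsubR.
Qed.

Let c_surj v : exists x, c x = v.
Proof.
have [q <-] := theta_surj v.
by have [x <-] := pi_surj q; exists x.
Qed.

Lemma coefficients_dimension : exists D, dimension [set: V] D.
Proof.
have [e [_ eP]] := free_exponents n.
apply: (@dimension_span _ _ n (fun i => c (rho (free_gen i)))) => v.
have [x <-] := c_surj v; have [u <-] := rho_surj x.
exists (fun i => (e i u)%:~R).
have crM : {morph c \o rho : x y / (x * y)%g >-> x + y}.
  by move=> a b; rewrite /= rhoM cM.
rewrite -[LHS]/((c \o rho) u) (eP _ _ crM); apply: eq_bigr => i _.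
by rewrite scaler_int.
Qed.

Let annihilator0 : set (G -> ('F_p)^o) :=
  cup_annihilator l `&` [set w | w g0 = 0].

Lemma functional_annihilates (psi : V -> ('F_p)^o) :
  linear psi -> annihilator0 (psi \o c).
Proof.
move=> psiL; have wM : cohomology1 G p (psi \o c).
  by move=> x y; rewrite /= cM (lfunD psiL).
have piC x : commsub setT setT x -> commsub setT setT (pi x).
  exact: gmorph_commsub.
split; last by rewrite /= /c commgg theta1 (lfun0 psiL).
(* The minus sign reconciles [thetaR] with the opposite sign in the formula that [cup_coboundary]
   asks of [phi]. *)
split=> //; apply: (@cup_coboundary _ _ (fun x => - psi (theta (pi x)))) => //.
- by rewrite gmorph1 // theta1 (lfun0 psiL) oppr0.
- by move=> x y /piC Cx /piC Cy; rewrite piM thetaM // (lfunD psiL) opprD.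
- move=> a b; rewrite gmorphR // thetaR.
  by rewrite (lfunB psiL) !(lfunZ psiL) opprB.
Qed.

(** A cochain [f] with coboundary [cup l w] kills [G_3] and passes to [Q]; being additive on the
    kernel of [lam], it yields a functional. *)
Lemma annihilator_functional w : annihilator0 w ->
  exists2 psi : V -> ('F_p)^o, linear psi & w = psi \o c.
Proof.
move=> [[wM [f fE]] /= wg0].
have fM x y : f (x * y)%g = f x + f y - (l x : 'F_p) * w y.
  have -> : (l x : 'F_p) * w y = f y - f (x * y)%g + f x by exact: fE.
  ring.
have f_pi x y : pi x = pi y -> f x = f y.
  move=> xy; have r1 : pi (x^-1 * y)%g = 1%g by rewrite piM gmorphV // xy mulVg.
  rewrite -[y](mulVKg x) (twistM_commsub wM fM); last exact: pi_ker.
  rewrite (twist_lower_central3 lM wM fM (x := (x^-1 * y)%g)) ?addr0 //.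
  exact/pi_eq1.
have [s sK] := choice pi_surj.
have [a b|psi psiL psiE] := theta_functional (f := f \o s).
  rewrite /ghom_ker /= => a0 b0.
  rewrite (f_pi _ (s a * s b)%g); last by rewrite piM !sK.
  by rewrite fM /l /= sK a0 mul0r subr0.
(* Since [w g0 = 0] and [l g0 = 1], [f [g0, x]] is [- w x]; hence the sign. *)
exists (fun v => - psi v) => [k u v|]; first by rewrite psiL opprD scalerN.
apply/funext => x /=; rewrite /c psiE; last exact: commsubR.
rewrite -(gmorphR piM) /= (f_pi _ [~ g0, x]%g) ?sK //.
by rewrite (twistR wM fM) wg0 mulr0 sub0r opprK /l /= lam_g0 mul1r.
Qed.

(** The annihilator is the line of [l] plus the classes vanishing at [g0], and the latter form the
    dual of [V]. *)
Lemma cup_annihilator_dimension D :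
  dimension [set: V] D -> dimension (cup_annihilator l) D.+1.
Proof.
move=> VD; apply: (@dimension_extend _ _ _ (fun w => w g0) l) => //.
- exact: subspace_cup_annihilator.
(* [l] annihilates itself: [l b * l a - l a * l b = 0], so [phi = 0] serves. *)
- split=> //; apply: (@cup_coboundary _ _ (fun=> 0)) => // [x y _ _|a b].
    by rewrite addr0.
  by rewrite mulrC subrr.
- apply: (dimension_dual c_surj functional_annihilates) => //.
  exact: annihilator_functional.
Qed.

Lemma coefficients_dimensionP d : dimension [set: V] d <->
  resonance G p d l /\ ~ resonance G p d.+1 l.
Proof.
have [D VD] := coefficients_dimension.
have annD := cup_annihilator_dimension VD.
split=> [Vd|[/(resonanceP _ lM annD) dD nd]].
  have -> : d = D.
    have le k m := @dimension_le _ V setT setT k m I (fun _ => id).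
    by apply/eqP; rewrite eqn_leq !le.
  split=> [|/(resonanceP _ lM annD)]; last by rewrite ltnn.
  exact/(resonanceP _ lM annD).
suff -> : d = D by [].
apply/eqP; rewrite eqn_leq dD leqNgt; apply/negP => dD'.
exact/nd/(resonanceP _ lM annD).
Qed.

End Character.

Lemma tau_tensor_dimensionP (lam : Q -> 'F_p) (g0 : G) (T : zmodType)
    (tau : Q -> T) d :
  {morph lam : x y / (x * y)%g >-> x + y} -> lam (pi g0) = 1 ->
  (forall a b, commsub setT setT a -> commsub setT setT b ->
     tau (a * b)%g = tau a + tau b) ->
  (forall k l, ghom_ker lam k -> ghom_ker lam l -> tau [~ k, l]%g = 0) ->
  (forall t, exists2 q, commsub setT setT q & tau q = t) ->
  (forall f : Q -> 'F_p,
     (forall a b, ghom_ker lam a -> ghom_ker lam b ->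
        f (a * b)%g = f a + f b) ->
     exists2 f' : T -> 'F_p, {morph f' : s t / s + t} &
       forall q, commsub setT setT q -> f' (tau q) = f q) ->
  dimension [set: tensor T 'F_p] d <->
  resonance G p d (lam \o pi) /\ ~ resonance G p d.+1 (lam \o pi).
Proof.
move=> lamM lam_g0 tauM tauRK tau_surj tau_functional.
apply: (@coefficients_dimensionP lam g0 _ (tau_tensor p tau)) => //.
- exact: tau_tensorM.
- exact: (tau_tensorR lamM lam_g0 quotient3_central).
- exact: (tau_tensor_surj lamM lam_g0 quotient3_central).
- move=> f /tau_functional[f' f'D f'E].
  have [psi psiL psiE] := @tensor_lift T 'F_p f' f'D.
  by exists psi => // q Cq; rewrite psiE f'E.
Qed.

Lemma tors_dimensionP (lam : Q -> 'F_p) (g0 : G) d : prime p ->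
  {morph lam : x y / (x * y)%g >-> x + y} -> lam (pi g0) = 1 ->
  tors_dimension p (ghom_ker lam) d <->
  resonance G p d (lam \o pi) /\ ~ resonance G p d.+1 (lam \o pi).
Proof.
move=> p_pr lamM lam_g0.
have commK := commsub_tors_ker p_pr lamM quotient3_central.
apply: (tau_tensor_dimensionP (tau := @tors_class Q p lam) _ lamM lam_g0).
- by move=> a b /commK ta /commK tb; exact: tors_classM.
- by move=> x y Kx Ky; exact: (tors_classRK p_pr lamM quotient3_central).
- move=> t; exact: (tors_class_surj lamM quotient3_torsion_free).
- move=> f /(tors_functional lamM)[f' f'D f'E].
  by exists f' => // q /commK; exact: f'E.
Qed.

End Presented.

(** * Subgroups of prime index *)

(* The group structure of H is transported to 'I_p, which is a finType.      *)
Section FiniteGroup.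
Local Open Scope group_scope.
Variables (H : groupType) (p : nat) (f : H -> 'I_p) (g : 'I_p -> H).
Variables (fK : cancel f g) (gK : cancel g f).

Definition finite_group of cancel f g & cancel g f := 'I_p.
Local Notation A := (finite_group fK gK).

Definition finite_mul (x y : A) : A := f (g x * g y).
Definition finite_one : A := f 1.
Definition finite_inv (x : A) : A := f (g x)^-1.

Lemma finite_mulA : associative finite_mul.
Proof. by move=> x y z; rewrite /finite_mul !fK mulgA. Qed.

Lemma finite_mul1 : left_id finite_one finite_mul.
Proof. by move=> x; rewrite /finite_mul fK mul1g gK. Qed.

Lemma finite_mulV : left_inverse finite_one finite_inv finite_mul.
Proof. by move=> x; rewrite /finite_mul fK mulVg. Qed.

HB.instance Definition _ := Finite.on A.
HB.instance Definition _ := Finite_isGroup.Build A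
  finite_mulA finite_mul1 finite_mulV.

Lemma prime_group_log : prime p -> exists (h : H) (log : H -> nat),
  (forall x, x = h ^+ log x) /\
  forall i j, h ^+ i = h ^+ j <-> i = j %[mod p].
Proof.
move=> p_pr; have cardA : #|[set: A]%G| = p by rewrite cardsT card_ord.
have /cyclicP[h hE] : cyclic [set: A]%G by apply: prime_cyclic; rewrite cardA.
have gX i : g (h ^+ i) = g h ^+ i.
  elim: i => [|i IHi]; first by rewrite !expg0 -[RHS]fK.
  by rewrite !expgS -IHi -[RHS]fK.
have oh : #[h] = p by rewrite orderE -hE cardA.
exists (g h).
have logP x : exists i, x = g h ^+ i.
  have /cycleP[i fx] : (f x : A) \in <[h]> by rewrite -hE inE.
  by exists i; rewrite -gX -fx fK.
have [log logE] := choice logP; exists log; split=> // i j.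
rewrite -!gX; split=> [/(can_inj gK)|] hij.
  by apply/eqP; rewrite -oh -eq_expg_mod_order; exact/eqP.
by move/eqP: hij; rewrite -oh -eq_expg_mod_order => /eqP ->.
Qed.

End FiniteGroup.

Section IndexP.
Local Open Scope card_scope.
Variables (Q : groupType) (p : nat).
Hypothesis p_pr : prime p.

Lemma Fp_natr_inj : {in `I_p &, injective (fun i => i%:R : 'F_p)}.
Proof.
move=> i j; rewrite !inE /= => ip jp /(congr1 (@nat_of_ord _)).
by rewrite !val_Fp_nat // !modn_small.
Qed.

(** The cosets are the fibres of [lam], and the powers of [g0] with exponents below [p] meet each of
    them once. *)
Lemma left_cosetsP (lam : Q -> 'F_p) g0 :
  {morph lam : x y / (x * y)%g >-> x + y} -> lam g0 = 1 ->
  left_cosets (ghom_ker lam) #= `I_p.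
Proof.
move=> lamM lam_g0.
have cosetE g : [set (g * k)%g | k in ghom_ker lam] = [set q | lam q = lam g].
  apply/seteqP; split=> [_ [k kK <-]|q /= qg].
    by rewrite /= lamM kK addr0.
  exists (g^-1 * q)%g; last by rewrite mulVKg.
  by rewrite /ghom_ker /= lamM (ghomV lamM) qg addNr.
have lamX i : lam (g0 ^+ i)%g = i%:R by rewrite (ghomX lamM) lam_g0.
have -> : left_cosets (ghom_ker lam) =
    (fun i : nat => [set q | lam q = i%:R]) @` `I_p.
  apply/seteqP; split=> [_ [g _ <-]|_ [i _ <-]].
    exists (nat_of_ord (lam g)); last by rewrite cosetE natr_Zp.
    by have := ltn_ord (lam g); rewrite [X in (_ < X)%N -> _](Fp_cast p_pr).
  by exists (g0 ^+ i)%g => //; rewrite cosetE lamX.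
apply: inj_card_eq => i j ip jp; rewrite -!lamX.
move=> /seteqP[/(_ (g0 ^+ i)%g erefl)].
by rewrite /= !lamX => ij _; exact: Fp_natr_inj.
Qed.

(** The quotient by [K] has [p] elements, one for each coset, so it is cyclic. [lam] is the discrete
    logarithm modulo [p], and [g0] lies over the generator. *)
Lemma index_ghom (K : set Q) : normal_subgroup K -> left_cosets K #= `I_p ->
  exists2 lam : Q -> 'F_p, {morph lam : x y / (x * y)%g >-> x + y} &
    K = ghom_ker lam /\ exists g0, lam g0 = 1.
Proof.
move=> Knormal /card_set_bijP[F [F_fun F_inj F_surj]].
pose H := group_quotient K; pose pi := quotient_pi K.
have piM : {morph pi : x y / (x * y)%g} by exact: quotient_piM.
have pi_surj y : exists x, pi x = y by exact: quotient_pi_surj.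
have pi_ker x : pi x = 1%g <-> K x.
  by rewrite quotient_pi_eq1 normal_closure_id.
pose fiber (u : H) : set Q := [set q | pi q = u].
have fiberE g : fiber (pi g) = [set (g * k)%g | k in K].
  apply/seteqP; split=> [q qg|_ [k /pi_ker k1 <-]]; last first.
    by rewrite /fiber /= piM k1 mulg1.
  exists (g^-1 * q)%g; last by rewrite mulVKg.
  by apply/pi_ker; rewrite piM gmorphV // qg mulVg.
have fiber_coset u : left_cosets K (fiber u).
  by have [g <-] := pi_surj u; exists g => //; rewrite fiberE.
pose f (u : H) : 'I_p := Ordinal (F_fun _ (fiber_coset u)).
have /choice[g gK] : forall i : 'I_p, exists u, f u = i.
  move=> i; have [_ [x _ <-] Fi] := F_surj _ (ltn_ord i).
  by exists (pi x); apply: val_inj; rewrite /= fiberE Fi.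
have f_inj : injective f.
  move=> u v [] /F_inj; rewrite !inE => /(_ (fiber_coset u) (fiber_coset v)) uv.
  have [x xu] := pi_surj u; have : fiber u x by [].
  by rewrite uv /fiber /= xu.
have fK : cancel f g by move=> u; apply: f_inj; rewrite gK.
have [h [log [logE logP]]] := prime_group_log fK (gK : cancel g f) p_pr.
pose lam x : 'F_p := (log (pi x))%:R.
have natr_log i j : (h ^+ i = h ^+ j)%g -> i%:R = j%:R :> 'F_p.
  move/logP => ij; apply: val_inj; rewrite /=.
  by rewrite !val_Fp_nat.
have lamM : {morph lam : x y / (x * y)%g >-> x + y}.
  move=> x y; rewrite /lam -natrD; apply: natr_log.
  by rewrite -logE expgnDr -!logE piM.
exists lam => //; split.
  apply/seteqP; split=> x.
    by move/pi_ker => x1; apply: (natr_log _ 0%N); rewrite -logE x1 expg0.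
  rewrite /ghom_ker /lam /= => x0; apply/pi_ker.
  have p_dvd : (p %| log (pi x))%N.
    by rewrite (dvdn_pcharf (pchar_Fp p_pr)); apply/eqP.
  by rewrite (logE (pi x)) -[RHS](expg0 h); apply/logP/eqP; rewrite mod0n.
have [x xh] := pi_surj h; exists x; apply: (natr_log _ 1%N).
by rewrite xh -logE expg1.
Qed.

Lemma ghom_normalize (lam : Q -> 'F_p) x :
  {morph lam : x y / (x * y)%g >-> x + y} -> lam x <> 0 ->
  exists g0, lam g0 = 1.
Proof.
move=> lamM /eqP x0; pose k : 'F_p := (lam x)^-1.
exists (x ^+ k)%g.
by rewrite (ghomX lamM) -mulr_natr natr_Zp mulfV.
Qed.

(** Each [x] is [g0] to the power [lam x] times an element of the kernel of [lam], which [mu] kills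
    too. *)
Lemma ghom_ker_eq (lam mu : Q -> 'F_p) g0 :
  {morph lam : x y / (x * y)%g >-> x + y} ->
  {morph mu : x y / (x * y)%g >-> x + y} -> lam g0 = 1 ->
  ghom_ker lam `<=` ghom_ker mu -> forall x, mu x = mu g0 * lam x.
Proof.
move=> lamM muM lam_g0 sub x.
have [k kK xE] := ghom_ker_decomp lamM lam_g0 x.
have := sub k kK; rewrite /ghom_ker /= => k0.
by rewrite {1}xE muM k0 addr0 (ghomX muM) -mulr_natr natr_Zp.
Qed.

End IndexP.

(** * Counting *)

Section Counting.
Local Open Scope card_scope.

(** Both images are quotients of [S] by the same equivalence relation. *)
Lemma card_image_fibers (T X Y : Type) (S : set T) (f : T -> X) (g : T -> Y) :
  (forall s t, S s -> S t -> f s = f t <-> g s = g t) ->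
  g @` S #= f @` S.
Proof.
move=> fg; have [[t0 _]|S0] := pselect (exists t, S t); last first.
  suff -> : S = set0 by rewrite !image_set0.
  by apply/seteqP; split=> // t St; case: S0; exists t.
(* [h] picks preimages in [S] over the image of [f]; elsewhere it needs the default [t0], so an
   empty [S] is treated apart. *)
have /choice[h hP] : forall x, exists t, (f @` S) x -> S t /\ f t = x.
  move=> x; have [[t St <-]|] := pselect ((f @` S) x); first by exists t.
  by exists t0.
have -> : g @` S = (g \o h) @` (f @` S).
  apply/seteqP; split=> [_ [t St <-]|_ [_ [t St <-] <-]] /=.
    have ft : (f @` S) (f t) by exists t.
    by exists (f t) => //; have [Sh /fg ->] := hP _ ft.
  have ft : (f @` S) (f t) by exists t.
  by have [Sh _] := hP _ ft; exists (h (f t)).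
apply: inj_card_eq => x y /set_mem/hP[Shx hx] /set_mem/hP[Shy hy] /= gxy.
by rewrite -hx -hy; apply/fg.
Qed.

Lemma card_fset_set_eq (X Y : choiceType) (A : set X) (B : set Y) :
  finite_set B -> A #= B -> #|` fset_set A| = #|` fset_set B|.
Proof.
move=> /finite_setP[n Bn] AB.
by rewrite (card_fset_set Bn) (card_fset_set (card_eq_trans AB Bn)).
Qed.

End Counting.

Lemma commutator_relators_presentation (G : groupType) :
  commutator_relators G ->
  exists (n : nat) (rho : free_group 'I_n -> G),
    [/\ {morph rho : x y / (x * y)%g}, forall x, exists u, rho u = x &
        forall u, rho u = 1%g -> commsub setT setT u].
Proof.
move=> [n [m [r [rC [f [[f' fK f'K] fM]]]]]].
exists n, (fun u => f' (quotient_pi (range r) u)); split=> [x y|x|u u1].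
- by apply: (can_inj fK); rewrite fM !f'K quotient_piM.
- have [u uE] := quotient_pi_surj (f x).
  by exists u; rewrite uE fK.
- have : quotient_pi (range r) u = 1%g.
    by rewrite -[LHS]f'K u1; exact: (gmorph1 fM).
  move/quotient_pi_eq1; apply: normal_closure_sub; first exact: commsub_normal.
  by move=> _ [j _ <-].
Qed.

Lemma finite_ghom (G : groupType) n p (rho : free_group 'I_n -> G) :
  {morph rho : x y / (x * y)%g} -> (forall x, exists u, rho u = x) ->
  finite_set [set l : G -> 'F_p | {morph l : x y / (x * y)%g >-> x + y}].
Proof.
move=> rhoM rho_surj; set S := [set l | _].
pose ev (l : G -> 'F_p) := [ffun i => l (rho (free_gen i))].
have ev_inj : {in S &, injective ev}.
  move=> l m /set_mem lM /set_mem mM lm; apply/funext => x.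
  have [u <-] := rho_surj x.
  apply: (@free_ghom_ext _ _ (l \o rho) (m \o rho)) => [a b|a b|i] /=.
  - by rewrite rhoM lM.
  - by rewrite rhoM mM.
  - by move/ffunP/(_ i): lm; rewrite !ffunE.
by rewrite -(eq_finite_set (inj_card_eq ev_inj)); exact: finite_finset.
Qed.

Section Lines.
Variables (G : groupType) (p : nat).
Implicit Types l m : G -> ('F_p)^o.

Lemma resonance_scale d (a : 'F_p) l :
  resonance G p d l -> resonance G p d (a *: l).
Proof.
move=> [lM [W [W1 Wsub Wd Wcup]]]; split.
  by move=> x y; rewrite !fctE lM scalerDr.
exists W; split=> // w /Wcup[f fE]; exists (fun x => a * f x) => x y.
have fE' : l x * w y = f y - f (x * y)%g + f x by exact: fE.
have -> : cup (a *: l) w x y = a * (l x * w y) by rewrite /cup !fctE mulrA.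
rewrite fE'; ring.
Qed.

Lemma line_self l : line l l.
Proof. by exists 1; rewrite ?scale1r. Qed.

(** A line in the set for [d + 1] may be given by another spanning vector; stability of resonance
    under scaling carries the property back to [l]. *)
Lemma proj_resonanceD d : proj_resonance G p d `\` proj_resonance G p d.+1 =
  @line G p @`
    [set l | [/\ resonance G p d l, l != 0 & ~ resonance G p d.+1 l]].
Proof.
apply/seteqP; split=> [L [[l [ld l0 ->]] nL]|_ [l [ld l0 nl] <-]].
  by exists l => //; split=> // ld1; apply: nL; exists l.
split; first by exists l.
move=> [m [md m0 lm]]; apply: nl.
have [a _ <-] : line m l by rewrite -lm; exact: line_self.
exact: resonance_scale.
Qed.

End Lines.

(** Finiteness accompanies the equality because [fset_set] sends infinite sets to the empty one. *)
Theorem theorem4p19 (G : groupType) (n p d : nat) :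
  commutator_relators G ->
  torsion_free (homology2 G) ->
  abelian_rank (group_quotient (lower_central G 2)) n ->
  prime p ->
  (d < n)%N ->
  [/\ finite_set (nu_set p d (group_quotient (lower_central G 3))),
      finite_set (proj_resonance G p d `\` proj_resonance G p d.+1) &
      nu p d (group_quotient (lower_central G 3)) =
        #|` fset_set (proj_resonance G p d `\` proj_resonance G p d.+1)|].
Proof.
move=> /commutator_relators_presentation[k [rho [rhoM rho_surj rho_ker]]].
move=> _ _ p_pr _.
pose Q := group_quotient (lower_central G 3).
pose pi := quotient_pi (lower_central G 3).
have piM : {morph pi : x y / (x * y)%g} by exact: quotient_piM.
have pi_surj y : exists x, pi x = y by exact: quotient_pi_surj.
(* Both sides are images of this set of characters: the subgroups are their kernels, the projective
   points the lines of their pullbacks to [G]. *)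
pose S := [set lam : Q -> 'F_p | [/\ {morph lam : x y / (x * y)%g >-> x + y},
  exists g0, lam g0 = 1, resonance G p d (lam \o pi) &
  ~ resonance G p d.+1 (lam \o pi)]].
have S_fin : finite_set S.
  apply: (@sub_finite_set _ _
    [set l : Q -> 'F_p | {morph l : x y / (x * y)%g >-> x + y}]).
    by move=> lam [].
  apply: (@finite_ghom _ k p (pi \o rho)) => [x y|y].
    by rewrite /= rhoM piM.
  by have [x <-] := pi_surj y; have [u <-] := rho_surj x; exists u.
have nuE : nu_set p d Q = @ghom_ker Q p @` S.
  apply/seteqP; split=> [K /nu_setP[Kn Kp Kd]|_ [lam [lamM [q q1] ld nl] <-]].
    have [lam lamM [KE [q q1]]] := index_ghom p_pr Kn Kp; rewrite KE in Kd.
    exists lam; last by rewrite KE.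
    have [g0 g0q] := pi_surj q; rewrite -g0q in q1.
    have dimP := tors_dimensionP rhoM rho_surj rho_ker d p_pr lamM q1.
    move/dimP: Kd => [ld nl].
    by split=> //; exists (pi g0).
  apply/nu_setP; split; [exact: ghom_ker_normal|exact: left_cosetsP q1|].
  have [g0 g0q] := pi_surj q; rewrite -g0q in q1.
  exact/(tors_dimensionP rhoM rho_surj rho_ker d p_pr lamM q1).
have PE : proj_resonance G p d `\` proj_resonance G p d.+1 =
    (fun lam : Q -> 'F_p => @line G p (lam \o pi)) @` S.
  rewrite proj_resonanceD; apply/seteqP.
  split=> [_ [l [ld l0 nl] <-]|_ [lam [lamM [q q1] ld nl] <-]].
    have [lM _] := ld.
    have [lam lamM lamE] := ghom_descend piM pi_surj (@pi_ker G) lM.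
    have lE : (lam \o pi : G -> ('F_p)^o) = l by apply/funext.
    exists lam; last by rewrite lE.
    split; rewrite ?lE //.
    have [x lx] : exists x, l x <> 0.
      apply: contrapT => /forallNP lx; case/eqP: l0; apply/funext => x.
      exact: contrapT (lx x).
    by apply: (ghom_normalize (x := pi x) lamM); rewrite lamE.
  exists (lam \o pi) => //; split=> //.
  apply/eqP => /(congr1 (@^~ (repr q))) /=.
  by rewrite /pi quotient_repr q1 => /eqP; rewrite oner_eq0.
have card_nu : @card_eq _ _ (nu_set p d Q)
    (proj_resonance G p d `\` proj_resonance G p d.+1).
  rewrite nuE PE; apply: card_image_fibers.
  (* Characters on one line are multiples of each other and have the same kernel; conversely, equal
     kernels make each a multiple of the other by [ghom_ker_eq]. *)
  move=> lam mu [lamM [q q1] _ _] [muM [r r1] _ _].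
  split=> [lm|klm].
    apply/seteqP; split=> x; rewrite /ghom_ker /= => x0.
      have [a _ /(congr1 (@^~ (repr x)))] :
          line (lam \o pi : G -> ('F_p)^o) (mu \o pi).
        by rewrite lm; exact: line_self.
      by rewrite /pi !fctE /= quotient_repr x0 scaler0 => <-.
    have [a _ /(congr1 (@^~ (repr x)))] :
        line (mu \o pi : G -> ('F_p)^o) (lam \o pi).
      by rewrite -lm; exact: line_self.
    by rewrite /pi !fctE /= quotient_repr x0 scaler0 => <-.
  have muE := ghom_ker_eq lamM muM q1 _; have lamE := ghom_ker_eq muM lamM r1 _.
  have sub_line (f g : Q -> 'F_p) c : (forall x, f x = c * g x) ->
      @line G p (f \o pi) `<=` @line G p (g \o pi).
    move=> fE _ [a _ <-]; exists (a * c) => //.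
    rewrite -scalerA; congr (_ *: _).
    by apply/funext => x; rewrite /= fE.
  by apply/seteqP; split; [apply: (sub_line _ _ _ (lamE _))|
    apply: (sub_line _ _ _ (muE _))]; rewrite klm.
split.
- by rewrite nuE; exact: finite_image.
- by rewrite PE; exact: finite_image.
- by apply: card_fset_set_eq => //; rewrite PE; exact: finite_image.
Qed.
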